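(* Let $n\ge 2$, let $k$ be a field of characteristic zero, let $R=k[[x_1,\ldots,x_n]]$, and let $f\in R$ be such that $R/\langle f\rangle$ is a reduced hypersurface ring with an isolated singularity (at the null point). Then the following are equivalent: (a) $R/\langle f\rangle$ is quasihomogeneous. (b) The Tjurina algebra $T_f=R/I_f$ is an Artinian Gorenstein ring. (c) The minimal number of generators of the ideal $I_f$ is $n$. (d) The matrix $\mathcal{Z}(I_f)_{\mathbf 0}$, with entries in $k$, has positive rank.
   Context: Write $f_{x_i}=\partial f/\partial x_i$, $J_f=\langle f_{x_1},\ldots,f_{x_n}\rangle\subset R$ and $I_f=\langle f, J_f\rangle\subset R$. That $R/\langle f\rangle$ has an isolated singularity (at the null point) means that $f$ and all $f_{x_i}$ lie in the maximal ideal $\langle x_1,\ldots,x_n\rangle$ of $R$ and that $J_f$ and $I_f$ are primary to this maximal ideal. $R/\langle f\rangle$ (or $f$) is called quasihomogeneous if $f\in J_f$ (equivalently, $I_f=J_f$). $\mathcal{Z}(I_f)$ denotes the syzygy matrix of the generators $f_{x_1},\ldots,f_{x_n},f$ of $I_f$, i.e. an $(n+1)\times m$ matrix over $R$ defining a finite free presentation $R^m\to R^{n+1}\to I_f\to 0$, where $R^{n+1}\to I_f$ sends the standard basis to $f_{x_1},\ldots,f_{x_n},f$. $\mathcal{Z}(I_f)_{\mathbf 0}$ is the matrix over $k$ obtained from $\mathcal{Z}(I_f)$ by evaluating $x_i\mapsto 0$ for all $i$. *)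

(* Defs.v *)
From HB Require Import structures.
From mathcomp Require Import all_boot all_order all_algebra.
From mathcomp Require Import generic_quotient ring_quotient.
From mathcomp Require Import boolp.
From mathcomp Require Import mpoly.

Set Implicit Arguments.
Unset Strict Implicit.
Unset Printing Implicit Defensive.

Import GRing.Theory.
Local Open Scope ring_scope.

(* [mpseries n k] is the ring k[[x_0, ..., x_(n-1)]]; a series coerces to its
   coefficient function. *)
Record mpseries (n : nat) (k : Type) :=
  MPSeries { mps_coef :> 'X_{1..n} -> k }.

Section PowerSeries.
Variables (n : nat) (k : comNzRingType).
Implicit Types (f g h : mpseries n k) (m : 'X_{1..n}).

HB.instance Definition _ := gen_eqMixin (mpseries n k).
HB.instance Definition _ := gen_choiceMixin (mpseries n k).

Lemma mpsP f g : (forall m, f m = g m) <-> f = g.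
Proof.
split=> [|->//]; case: f g => [f] [g] /= efg.
by congr MPSeries; apply: funext.
Qed.

Definition mps_zero : mpseries n k := MPSeries (fun=> 0).
Definition mps_opp f : mpseries n k := MPSeries (fun m => - f m).
Definition mps_add f g : mpseries n k := MPSeries (fun m => f m + g m).

Fact mps_addA : associative mps_add.
Proof. by move=> f g h; apply/mpsP => m /=; rewrite addrA. Qed.
Fact mps_addC : commutative mps_add.
Proof. by move=> f g; apply/mpsP => m /=; rewrite addrC. Qed.
Fact mps_add0 : left_id mps_zero mps_add.
Proof. by move=> f; apply/mpsP => m /=; rewrite add0r. Qed.
Fact mps_addN : left_inverse mps_zero mps_opp mps_add.
Proof. by move=> f; apply/mpsP => m /=; rewrite addNr. Qed.

HB.instance Definition _ :=
  GRing.isZmodule.Build (mpseries n k) mps_addA mps_addC mps_add0 mps_addN.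

Definition mps_one : mpseries n k := MPSeries (fun m => (m == 0%MM)%:R).

(* The Cauchy product.  The bounds only make the index type finite: the sum is
   over all pairs of exponents adding up to m, as in [mcoeffM]. *)
Definition mps_mul f g : mpseries n k := MPSeries (fun m =>
  \sum_(u : 'X_{1..n < (mdeg m).+1, (mdeg m).+1} | m == (u.1 + u.2)%MM)
     f u.1 * g u.2).

Definition mps_trunc d f : {mpoly k[n]} :=
  \sum_(u : 'X_{1..n < d}) f u *: 'X_[u].

Lemma mcoeff_trunc d f m : (mdeg m < d)%N -> (mps_trunc d f)@_m = f m.
Proof.
move=> ltmd; rewrite raddf_sum /= (bigD1 (BMultinom ltmd)) //=.
rewrite mcoeffZ mcoeffX eqxx mulr1 big1 ?addr0 // => u neq_u.
rewrite mcoeffZ mcoeffX; case: eqP => [e|_]; last by rewrite mulr0.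
by case/eqP: neq_u; apply/val_inj.
Qed.

Lemma eq_mcoeffM_deg d (p p' q q' : {mpoly k[n]}) m : (mdeg m < d)%N ->
    (forall u, (mdeg u < d)%N -> p@_u = p'@_u) ->
    (forall u, (mdeg u < d)%N -> q@_u = q'@_u) ->
  (p * q)@_m = (p' * q')@_m.
Proof.
move=> ltmd ep eq; rewrite !mcoeffM; apply: eq_bigr => -[[u ltu] [v ltv]] _ /=.
by rewrite ep ?eq //; [apply: leq_trans ltv _ | apply: leq_trans ltu _].
Qed.

Lemma mps_mul_trunc d f g m : (mdeg m < d)%N ->
  mps_mul f g m = (mps_trunc d f * mps_trunc d g)@_m.
Proof.
move=> ltmd; rewrite mcoeffM; apply: eq_bigr => -[[u ltu] [v ltv]] _ /=.
by rewrite !mcoeff_trunc //; [apply: leq_trans ltv _ | apply: leq_trans ltu _].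
Qed.

Fact mps_mulA : associative mps_mul.
Proof.
move=> f g h; apply/mpsP => m; have ltm := ltnSn (mdeg m).
rewrite !(mps_mul_trunc _ _ ltm).
rewrite (eq_mcoeffM_deg (p' := mps_trunc (mdeg m).+1 f)
  (q' := mps_trunc (mdeg m).+1 g * mps_trunc (mdeg m).+1 h) ltm) //; last first.
  by move=> u ltu; rewrite mcoeff_trunc // (mps_mul_trunc _ _ ltu).
rewrite mulrA; apply: (eq_mcoeffM_deg ltm) => // u ltu.
by rewrite mcoeff_trunc // (mps_mul_trunc _ _ ltu).
Qed.

Fact mps_mulC : commutative mps_mul.
Proof.
move=> f g; apply/mpsP => m; have ltm := ltnSn (mdeg m).
by rewrite !(mps_mul_trunc _ _ ltm) mulrC.
Qed.

Fact mps_mul1 : left_id mps_one mps_mul.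
Proof.
move=> f; apply/mpsP => m; have ltm := ltnSn (mdeg m).
rewrite (mps_mul_trunc _ _ ltm).
rewrite (eq_mcoeffM_deg (p' := 1) (q' := mps_trunc (mdeg m).+1 f) ltm) //.
  by rewrite mul1r mcoeff_trunc.
by move=> u ltu; rewrite mcoeff_trunc // mcoeff1.
Qed.

Fact mps_mulDl : left_distributive mps_mul mps_add.
Proof.
move=> f g h; apply/mpsP => m /=.
by rewrite -big_split; apply: eq_bigr => u _ /=; rewrite mulrDl.
Qed.

Fact mps_one_neq0 : mps_one != 0.
Proof.
apply/eqP => /mpsP /(_ 0%MM) /= /eqP.
by rewrite eqxx oner_eq0.
Qed.

HB.instance Definition _ := GRing.Zmodule_isComNzRing.Build (mpseries n k)
  mps_mulA mps_mulC mps_mul1 mps_mulDl mps_one_neq0.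

Definition mpsX (i : 'I_n) : mpseries n k :=
  MPSeries (fun m => (m == U_(i)%MM)%:R).

Definition mps_deriv (i : 'I_n) f : mpseries n k :=
  MPSeries (fun m => f (m + U_(i))%MM *+ (m i).+1).

Definition mps_eval0 f : k := f 0%MM.

End PowerSeries.

(* Ideals are treated as (classically decidable) predicates. *)
Section Ideals.
Variable R : comPzRingType.
Implicit Types I J : {pred R}.

Definition is_ideal I :=
  [/\ 0 \in I, {in I &, forall x y, x + y \in I}
    & forall a, {in I, forall x, a * x \in I}].

Definition maximal_ideal I :=
  [/\ is_ideal I, 1 \notin I &
      forall J, is_ideal J -> 1 \notin J -> {subset I <= J} -> {subset J <= I}].

Definition primary_ideal I :=
  [/\ is_ideal I, 1 \notin I &
      forall x y, x * y \in I -> x \in I \/ exists e : nat, y ^+ e \in I].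

Definition primary_to I J :=
  primary_ideal I /\ forall x, x \in J <-> exists e : nat, x ^+ e \in I.

Definition ideal_span s (g : 'rV[R]_s) : {pred R} :=
  fun x => `[< exists a : 'cV[R]_s, g *m a = x%:M >].

(* Generating sets may contain repetitions and zeros, which does not affect
   the minimum. *)
Definition min_num_generators I (r : nat) :=
  (exists g : 'rV[R]_r, ideal_span g =i I) /\
  (forall s (g : 'rV[R]_s), ideal_span g =i I -> (r <= s)%N).

(* Z presents the ideal generated by g:  R^m --Z--> R^s --g--> (g) --> 0  is
   exact; exactness at (g) holds by definition of [ideal_span]. *)
Definition presentation_matrix s m (g : 'rV[R]_s) (Z : 'M[R]_(s, m)) :=
  forall v : 'cV[R]_s, g *m v = 0 <-> exists w : 'cV[R]_m, v = Z *m w.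

Definition reduced_ring := forall (x : R) (e : nat), x ^+ e = 0 -> x = 0.

Definition noetherian_ring := forall I : nat -> {pred R},
  (forall j, is_ideal (I j)) -> (forall j, {subset I j <= I j.+1}) ->
  exists N, forall j, (N <= j)%N -> I j =i I N.

Definition artinian_ring := forall I : nat -> {pred R},
  (forall j, is_ideal (I j)) -> (forall j, {subset I j.+1 <= I j}) ->
  exists N, forall j, (N <= j)%N -> I j =i I N.

Definition local_ring :=
  exists I, maximal_ideal I /\ forall J, maximal_ideal J -> J =i I.

End Ideals.

Section Gorenstein.
Variable A : comPzRingType.

Definition injective_module (E : lmodType A) :=
  forall (M N : lmodType A) (i : {linear M -> N}) (g : {linear M -> E}),
    injective i -> exists h : {linear N -> E}, forall x, h (i x) = g x.

(* There is an injective resolution 0 -> M -> E_0 -> ... -> E_d -> 0; it is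
   padded by zero modules beyond d. *)
Definition inj_dim_le (M : lmodType A) (d : nat) :=
  exists (E : nat -> lmodType A) (eta : {linear M -> E 0%N})
         (delta : forall i, {linear E i -> E i.+1}),
    [/\ forall i, injective_module (E i),
        injective eta,
        forall y, delta 0%N y = 0 <-> exists x, y = eta x,
        forall i y, delta i.+1 y = 0 <-> exists x, y = delta i x
      & forall i, (d < i)%N -> forall y : E i, y = 0].

(* For a local ring: Noetherian of finite injective dimension over itself. *)
Definition gorenstein_local_ring :=
  [/\ noetherian_ring A, local_ring A & exists d, inj_dim_le (A^o : lmodType A) d].

End Gorenstein.

Section QuotientRing.
Variables (R : comPzRingType) (s : nat) (g : 'rV[R]_s).
Local Open Scope quotient_scope.

Lemma ideal_spanP x :
  reflect (exists a : 'cV[R]_s, g *m a = x%:M) (x \in ideal_span g).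
Proof. exact: asboolP. Qed.

Fact ideal_span_is_ideal : is_ideal (ideal_span g).
Proof.
split=> [|x y /ideal_spanP[a ga] /ideal_spanP[b gb]|c x /ideal_spanP[a ga]];
  apply/ideal_spanP.
- by exists 0; rewrite mulmx0 raddf0.
- by exists (a + b); rewrite mulmxDr ga gb raddfD.
- by exists (c *: a); rewrite -scalemxAr ga scale_scalar_mx.
Qed.

Fact ideal_span_zmod_closed : zmod_closed (ideal_span g).
Proof.
have [I0 ID IM] := ideal_span_is_ideal; split=> // x y Ix Iy.
by rewrite -mulN1r ID ?IM.
Qed.
HB.instance Definition _ :=
  GRing.isZmodClosed.Build R (ideal_span g) ideal_span_zmod_closed.

(* Unlike [{ideal_quot I}], this does not require the ideal to be proper. *)
Definition quot_span := Quotient.quot (ideal_span g).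
HB.instance Definition _ := GRing.Zmodule.on quot_span.

Definition quot_span_pi (x : R) : quot_span := \pi_(Quotient.quot (ideal_span g)) x.
Definition quot_span_repr (x : quot_span) : R := repr (x : Quotient.quot (ideal_span g)).

Lemma quot_span_reprK : cancel quot_span_repr quot_span_pi.
Proof. exact: reprK. Qed.

Lemma quot_span_piE x y :
  quot_span_pi x = quot_span_pi y <-> x - y \in ideal_span g.
Proof. by rewrite Quotient.idealrBE; split=> /eqP. Qed.

Lemma quot_span_piD : {morph quot_span_pi : x y / x + y}.
Proof. by move=> x y; apply: Quotient.pi_add. Qed.

Definition quot_span_mul (x y : quot_span) : quot_span :=
  quot_span_pi (quot_span_repr x * quot_span_repr y).

Lemma quot_span_piM x y :
  quot_span_pi (x * y) = quot_span_mul (quot_span_pi x) (quot_span_pi y).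
Proof.
have [_ ID IM] := ideal_span_is_ideal.
apply/quot_span_piE; set x' := quot_span_repr _; set y' := quot_span_repr _.
have -> : x * y - x' * y' = x * (y - y') + y' * (x - x').
  by rewrite !mulrBr [y' * x]mulrC [y' * x']mulrC addrA subrK.
by rewrite ID ?IM //; apply/quot_span_piE; rewrite quot_span_reprK.
Qed.

Fact quot_span_mulA : associative quot_span_mul.
Proof.
move=> x y z; rewrite -[x]quot_span_reprK -[y]quot_span_reprK -[z]quot_span_reprK.
by rewrite -!quot_span_piM mulrA.
Qed.
Fact quot_span_mulC : commutative quot_span_mul.
Proof. by move=> x y; rewrite /quot_span_mul mulrC. Qed.
Fact quot_span_mul1 : left_id (quot_span_pi 1) quot_span_mul.
Proof. by move=> x; rewrite -[x]quot_span_reprK -quot_span_piM mul1r. Qed.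
Fact quot_span_mulDl : left_distributive quot_span_mul +%R.
Proof.
move=> x y z; rewrite -[x]quot_span_reprK -[y]quot_span_reprK -[z]quot_span_reprK.
by rewrite -quot_span_piD -!quot_span_piM mulrDl quot_span_piD.
Qed.

HB.instance Definition _ := GRing.Zmodule_isComPzRing.Build quot_span
  quot_span_mulA quot_span_mulC quot_span_mul1 quot_span_mulDl.

End QuotientRing.

Section Hypersurface.
Variables (n : nat) (k : comNzRingType) (f : mpseries n k).

Definition null_ideal : {pred mpseries n k} :=
  ideal_span (\row_(i < n) mpsX k i).

Definition jacobian_gens : 'rV[mpseries n k]_n := \row_(i < n) mps_deriv i f.
Definition tjurina_gens : 'rV[mpseries n k]_(n + 1) := row_mx jacobian_gens f%:M.

Definition jacobian_ideal := ideal_span jacobian_gens.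
Definition tjurina_ideal := ideal_span tjurina_gens.

Definition hypersurface_ring : comPzRingType :=
  quot_span (f%:M : 'rV[mpseries n k]_1).
Definition tjurina_algebra : comPzRingType := quot_span tjurina_gens.

Definition isolated_singularity :=
  [/\ f \in null_ideal, forall i, mps_deriv i f \in null_ideal,
      primary_to jacobian_ideal null_ideal
    & primary_to tjurina_ideal null_ideal].

Definition quasihomogeneous := f \in jacobian_ideal.

End Hypersurface.

(* Main.v *)
(* Write J for the Jacobian ideal, I = J + (f), m for the maximal ideal.

   If a syzygy of (f_1, ..., f_n, f) has a unit among its first n entries, the
   corresponding derivation d maps I into itself and some d x_i is a unit, so
   x_i^e in I implies x_i^(e-1) in I (characteristic zero), down to 1 in I: a
   contradiction. So a syzygy with a unit entry has it in front of f, whence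
   f in J; comparing ranks modulo m, this yields (a) <-> (c) <-> (d).

   J is a complete intersection: if x_i^M = sum_j f_j a_ji then
   J = (x_1^M, ..., x_n^M) : det a, and R/J inherits from R/(x_1^M, ..., x_n^M)
   a functional inducing a perfect pairing, which makes it self-injective; this
   is (a) -> (b).

   Conversely, if R/I has finite injective dimension then its socle is simple, so
   I also carries such a functional; then J : f = J + (g) and J : g = I for some
   g. If all syzygies had entries in m, the Koszul complex of (f_1, ..., f_n, f)
   with one divided power variable adjoined would be an infinite minimal free
   resolution of R/I (Tate, Gulliksen), contradicting Hilbert's syzygy theorem.
   Unwound in the Koszul complex of x_1, ..., x_n, the contradiction is that W^N
   is a boundary modulo I for N large (it vanishes), hence for N = 0. *)

Require Import Defs.
From HB Require Import structures.
From mathcomp Require Import all_boot all_order all_algebra.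
From mathcomp Require Import boolp mpoly ring.
From mathcomp Require classical_sets.
Set Implicit Arguments.
Unset Strict Implicit.
Unset Printing Implicit Defensive.
Import GRing.Theory.
Local Open Scope ring_scope.

(** * Formal power series *)

Section PowerSeriesTheory.
Variables (n : nat) (k : comNzRingType).
Implicit Types (f g h : mpseries n k) (m u : 'X_{1..n}).

Lemma mpsD f g m : (f + g) m = f m + g m. Proof. by []. Qed.
Lemma mpsN f m : (- f) m = - f m. Proof. by []. Qed.
Lemma mpsMn f r m : (f *+ r) m = f m *+ r.
Proof. by elim: r => [|r IHr] //; rewrite !mulrS -IHr. Qed.
Lemma mps_sum (I : Type) (r : seq I) (P : pred I) (F : I -> mpseries n k) m :
  (\sum_(i <- r | P i) F i) m = \sum_(i <- r | P i) F i m.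
Proof. by elim/big_rec2: _ => // i x y _ <-. Qed.

Lemma mpsM_trunc d f g m : (mdeg m < d)%N ->
  (f * g) m = (mps_trunc d f * mps_trunc d g)@_m.
Proof. exact: mps_mul_trunc. Qed.

(** A coefficient of a product involves only coefficients of no larger degree, so identities in
    [{mpoly k[n]}] transfer to series one coefficient at a time. *)
Lemma mpsM_poly f g (p q : {mpoly k[n]}) m :
    (forall u, (mdeg u <= mdeg m)%N -> f u = p@_u) ->
    (forall u, (mdeg u <= mdeg m)%N -> g u = q@_u) ->
  (f * g) m = (p * q)@_m.
Proof.
move=> fp gq; rewrite (mpsM_trunc f g (ltnSn _)).
by apply: (eq_mcoeffM_deg (ltnSn _)) => u lu; rewrite mcoeff_trunc // ?fp ?gq.
Qed.

Definition mpsC (c : k) : mpseries n k := MPSeries (fun m => c *+ (m == 0%MM)).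

Lemma mpsCM c f m : (mpsC c * f) m = c * f m.
Proof.
rewrite (@mpsM_poly _ _ c%:MP (mps_trunc (mdeg m).+1 f)).
- by rewrite mcoeffCM mcoeff_trunc.
- by move=> u _; rewrite mcoeffC /= mulr_natr eq_sym.
- by move=> u lu; rewrite mcoeff_trunc.
Qed.

Lemma mpsC1 : mpsC 1 = 1. Proof. exact/mpsP. Qed.
Lemma mpsCD : {morph mpsC : a b / a + b}.
Proof. by move=> a b; apply/mpsP => m /=; rewrite mulrnDl. Qed.
Lemma mpsCMC : {morph mpsC : a b / a * b}.
Proof. by move=> a b; apply/mpsP => m; rewrite mpsCM /= mulrnAr. Qed.

Lemma mpsM_eval0 f g : (f * g) 0%MM = f 0%MM * g 0%MM.
Proof.
rewrite (@mpsM_poly _ _ (f 0%MM)%:MP (g 0%MM)%:MP).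
- by rewrite mcoeffCM mcoeffC eqxx mulr1.
- by move=> u; rewrite mdeg0 leqn0 mdeg_eq0 => /eqP->; rewrite mcoeffC eqxx mulr1.
- by move=> u; rewrite mdeg0 leqn0 mdeg_eq0 => /eqP->; rewrite mcoeffC eqxx mulr1.
Qed.

Definition mpsXm u : mpseries n k := MPSeries (fun m => (m == u)%:R).

Lemma mpsXmE u m : mpsXm u m = (m == u)%:R. Proof. by []. Qed.

Lemma mpsXmM u f m : (mpsXm u * f) (u + m)%MM = f m.
Proof.
rewrite (@mpsM_poly _ _ 'X_[u] (mps_trunc (mdeg (u + m)).+1 f)).
- by rewrite mulrC mcoeffMX mcoeff_trunc // mdegD ltnS leq_addl.
- by move=> v _; rewrite mcoeffX eq_sym.
- by move=> v lv; rewrite mcoeff_trunc.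
Qed.

Lemma mpsXmM0 u f m : ~~ (u <= m)%MM -> (mpsXm u * f) m = 0.
Proof.
move=> num; rewrite (@mpsM_poly _ _ 'X_[u] (mps_trunc (mdeg m).+1 f)).
- rewrite mcoeffM big1 // => -[v w] /= /eqP mE; rewrite mcoeffX.
  case: eqP => [uv|_]; last by rewrite mul0r.
  by rewrite mE uv lem_addr in num.
- by move=> v _; rewrite mcoeffX eq_sym.
- by move=> v lv; rewrite mcoeff_trunc.
Qed.

Lemma mpsXmD u v : mpsXm (u + v) = mpsXm u * mpsXm v.
Proof.
apply/mpsP => m; have [le|num] := boolP (u <= m)%MM.
  by rewrite -(submK le) (addmC (m - u)%MM) mpsXmM /= eqm_add2l.
rewrite mpsXmM0 //=; case: eqP num => // ->.
by rewrite lem_addr.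
Qed.

Lemma mpsX_mpsXm i : mpsX k i = mpsXm U_(i). Proof. by []. Qed.

Lemma mpsXm0 : mpsXm 0%MM = 1. Proof. by []. Qed.

Lemma mpsX_exp i e : mpsX k i ^+ e = mpsXm (U_(i) *+ e).
Proof.
elim: e => [|e IHe]; first by rewrite expr0 mulm0n.
by rewrite exprS IHe mulmS mpsXmD.
Qed.

Lemma mps_derivE i f g : (forall m, g m = f (m + U_(i))%MM *+ (m i).+1) ->
  mps_deriv i f = g.
Proof. by move=> fg; apply/mpsP. Qed.

Lemma mps_derivD i : {morph @mps_deriv n k i : f g / f + g}.
Proof. by move=> f g; apply: mps_derivE => m; rewrite !mpsD mulrnDl. Qed.

Lemma mps_deriv_trunc i f d m : (mdeg m < d)%N ->
  (mps_trunc d.+1 f)^`M(i)@_m = mps_deriv i f m.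
Proof. by move=> ltm; rewrite mcoeff_deriv mcoeff_trunc // mdegD mdeg1 addn1. Qed.

Lemma mps_derivM i f g :
  mps_deriv i (f * g) = mps_deriv i f * g + f * mps_deriv i g.
Proof.
apply/mpsP => m; rewrite mpsD.
(* A derivative costs one degree, so the truncation keeps degrees up to [mdeg m + 1]. *)
rewrite (@mpsM_poly _ _ (mps_trunc (mdeg m).+2 f)^`M(i) (mps_trunc (mdeg m).+2 g)).
- rewrite (@mpsM_poly _ _ (mps_trunc (mdeg m).+2 f) (mps_trunc (mdeg m).+2 g)^`M(i)).
  + rewrite -mcoeffD -mderivM mcoeff_deriv /=; congr (_ *+ _).
    by apply: mps_mul_trunc; rewrite mdegD mdeg1 addn1.
  + by move=> u lu; rewrite mcoeff_trunc // ltnS leqW.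
  + by move=> u lu; rewrite mps_deriv_trunc.
- by move=> u lu; rewrite mps_deriv_trunc.
- by move=> u lu; rewrite mcoeff_trunc // ltnS leqW.
Qed.

Lemma mps_deriv_comm i j f :
  mps_deriv i (mps_deriv j f) = mps_deriv j (mps_deriv i f).
Proof.
apply/mpsP => m /=; rewrite -!addmA [(U_(_) + _)%MM]addmC -!mulrnA; congr (_ *+ _).
rewrite !mnmDE !mnm1E [j == i]eq_sym; case: eqP => [->|_] //.
by rewrite !addn0 mulnC.
Qed.

Lemma mps_derivX (i j : 'I_n) : mps_deriv i (mpsX k j) = (i == j)%:R.
Proof.
apply: mps_derivE => m /=; case: (eqVneq i j) => [<-|neq] /=.
  have -> : (m + U_(i) == U_(i))%MM = (m == 0%MM).
    by rewrite -{2}[U_(i)%MM]add0m eqm_add2r.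
  by case: eqP => [->|_]; rewrite ?mul0rn // mnm0E.
case: eqP => [/(congr1 (fun u : 'X_{1..n} => u i))|_]; last by rewrite mul0rn.
by rewrite mnmDE !mnm1E eqxx [j == i]eq_sym (negPf neq) addn1.
Qed.

End PowerSeriesTheory.

(** * The Koszul complex as a Fock space *)

Section Fock.
Variable R : comNzRingType.

(* The exterior algebra of R^n, coded as 2^n-dimensional column vectors through
   Lambda_(m+1) = Lambda_m + xi_m Lambda_m: [creation a] is the wedge product
   with a and [annihilation f] the Koszul differential of the sequence f. *)
Fixpoint fock_dim n := if n is m.+1 then (fock_dim m + fock_dim m)%N else 1%N.

Definition ord_init n (a : 'I_n.+1 -> R) : 'I_n -> R :=
  fun i => a (widen_ord (leqnSn n) i).

Fixpoint creation n : ('I_n -> R) -> 'M[R]_(fock_dim n) :=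
  match n with
  | 0 => fun=> 0
  | m.+1 => fun a => block_mx (creation (ord_init a)) 0
                              (a ord_max)%:M (- creation (ord_init a))
  end.

Fixpoint annihilation n : ('I_n -> R) -> 'M[R]_(fock_dim n) :=
  match n with
  | 0 => fun=> 0
  | m.+1 => fun a => block_mx (annihilation (ord_init a)) (a ord_max)%:M
                              0 (- annihilation (ord_init a))
  end.

(** The number operator: it multiplies p-vectors by p, so that homogeneity becomes an eigenvector
    equation. *)
Fixpoint fock_degree n : 'M[R]_(fock_dim n) :=
  if n is m.+1 then block_mx (fock_degree m) 0 0 (fock_degree m + 1%:M) else 0.

(** The unit of the exterior algebra; [covacuum] reads off its coefficient, and [top_form],
    [top_coform] are their analogues in degree n. *)
Fixpoint vacuum n : 'cV[R]_(fock_dim n) :=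
  if n is m.+1 then col_mx (vacuum m) 0 else 1%:M.

Fixpoint covacuum n : 'rV[R]_(fock_dim n) :=
  if n is m.+1 then row_mx (covacuum m) 0 else 1%:M.

Fixpoint top_form n : 'cV[R]_(fock_dim n) :=
  if n is m.+1 then col_mx 0 (top_form m) else 1%:M.

Fixpoint top_coform n : 'rV[R]_(fock_dim n) :=
  if n is m.+1 then row_mx 0 (top_coform m) else 1%:M.

Definition dotf n (f a : 'I_n -> R) := \sum_(i < n) f i * a i.

Lemma creation0 n : creation (fun _ : 'I_n => 0) = 0.
Proof. by elim: n => //= n IHn; rewrite /ord_init IHn oppr0 raddf0 block_mx0. Qed.

Lemma creation_linear n c (a b : 'I_n -> R) :
  creation (fun i => c * a i + b i) = c *: creation a + creation b.
Proof.
elim: n a b => [|n IHn] a b /=; first by rewrite scaler0 addr0.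
rewrite scale_block_mx add_block_mx -IHn scaler0 addr0 scale_scalar_mx.
by rewrite scalerN -opprD -IHn raddfD.
Qed.

Lemma creation_sum n (I : Type) (r : seq I) (c : I -> R) (a : I -> 'I_n -> R) :
  creation (fun i => \sum_(j <- r) c j * a j i) =
  \sum_(j <- r) c j *: creation (a j).
Proof.
elim: r => [|j r IHr].
  rewrite big_nil -(creation0 n); congr creation.
  by apply: funext => i; rewrite big_nil.
rewrite big_cons -IHr -creation_linear; congr creation.
by apply: funext => i; rewrite big_cons.
Qed.

(** Contraction is an antiderivation of the exterior algebra, whence this canonical anticommutation
    relation. *)
Lemma annihilation_creation n (f a : 'I_n -> R) :
  annihilation f *m creation a + creation a *m annihilation f = (dotf f a)%:M.
Proof.
elim: n f a => [|n IHn] f a /=.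
  by rewrite mulmx0 addr0 /dotf big_ord0 raddf0.
rewrite !mulmx_block !mul0mx !mulmx0 !addr0 !add0r add_block_mx.
rewrite !mulmxN !mulNmx !opprK !mul_scalar_mx !mul_mx_scalar.
rewrite /dotf big_ord_recr /= -/(dotf (ord_init f) (ord_init a)).
rewrite !addNr !scale_scalar_mx [a _ * f _]mulrC addrAC IHn addrCA IHn addrC.
by rewrite -raddfD scalar_mx_block [f _ * a _ + _]addrC.
Qed.

Lemma annihilationK n (f a : 'I_n -> R) :
  annihilation f *m creation a = (dotf f a)%:M - creation a *m annihilation f.
Proof. by rewrite -annihilation_creation addrK. Qed.

Lemma annihilation0 n : annihilation (fun _ : 'I_n => 0) = 0.
Proof. by elim: n => //= n IHn; rewrite /ord_init IHn oppr0 raddf0 block_mx0. Qed.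

Lemma annihilation_linear n c (a b : 'I_n -> R) :
  annihilation (fun i => c * a i + b i) = c *: annihilation a + annihilation b.
Proof.
elim: n a b => [|n IHn] a b /=; first by rewrite scaler0 addr0.
rewrite scale_block_mx add_block_mx -IHn scaler0 addr0 scale_scalar_mx.
by rewrite scalerN -opprD -IHn raddfD.
Qed.

Lemma annihilation_sum n (I : Type) (r : seq I) (c : I -> R) (a : I -> 'I_n -> R) :
  annihilation (fun i => \sum_(j <- r) c j * a j i) =
  \sum_(j <- r) c j *: annihilation (a j).
Proof.
elim: r => [|j r IHr].
  rewrite big_nil -(annihilation0 n); congr annihilation.
  by apply: funext => i; rewrite big_nil.
rewrite big_cons -IHr -annihilation_linear; congr annihilation.
by apply: funext => i; rewrite big_cons.
Qed.

Definition ord_delta n (j : 'I_n) : 'I_n -> R := fun i => (j == i)%:R.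

Lemma dotf_delta n (f : 'I_n -> R) j : dotf f (ord_delta j) = f j.
Proof.
rewrite /dotf (bigD1 j) //= /ord_delta eqxx mulr1 big1 ?addr0 // => i.
by rewrite eq_sym => /negPf->; rewrite mulr0.
Qed.

Lemma sum_ord_delta n (c : 'I_n -> R) :
  c = fun i => \sum_j c j * ord_delta j i.
Proof.
apply: funext => i; rewrite -[LHS](dotf_delta c); apply: eq_bigr => j _.
by rewrite /ord_delta eq_sym.
Qed.

Lemma creation_delta n (c : 'I_n -> R) :
  creation c = \sum_j c j *: creation (ord_delta j).
Proof. by rewrite -creation_sum -sum_ord_delta. Qed.

Lemma annihilation_delta n (c : 'I_n -> R) :
  annihilation c = \sum_j c j *: annihilation (ord_delta j).
Proof. by rewrite -annihilation_sum -sum_ord_delta. Qed.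

Lemma covacuum_annihilation n (f : 'I_n -> R) (v : 'cV[R]_(fock_dim n)) :
  exists q, (covacuum n *m (annihilation f *m v)) 0 0 = dotf f q.
Proof.
exists (fun j => (covacuum n *m (annihilation (ord_delta j) *m v)) 0 0).
rewrite annihilation_delta mulmx_suml mulmx_sumr summxE; apply: eq_bigr => j _.
by rewrite -scalemxAl -scalemxAr mxE.
Qed.

Lemma creation_sqr n (a : 'I_n -> R) : creation a *m creation a = 0.
Proof.
elim: n a => [|n IHn] a /=; first by rewrite mulmx0.
rewrite mulmx_block !mul0mx !mulmx0 !mulmxN !mulNmx !IHn !mul_scalar_mx.
by rewrite !mul_mx_scalar subrr !addr0 opprK add0r block_mx0.
Qed.

Lemma annihilation_sqr n (f : 'I_n -> R) : annihilation f *m annihilation f = 0.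
Proof.
elim: n f => [|n IHn] f /=; first by rewrite mulmx0.
rewrite mulmx_block !mul0mx !mulmx0 !mulmxN !mulNmx !IHn !mul_scalar_mx.
by rewrite !mul_mx_scalar subrr !addr0 opprK add0r block_mx0.
Qed.

Lemma creation_anticomm n (a b : 'I_n -> R) :
  creation a *m creation b = - (creation b *m creation a).
Proof.
have := creation_sqr (fun i => 1 * a i + b i).
rewrite creation_linear scale1r mulmxDl !mulmxDr !creation_sqr addr0 add0r.
by move/eqP; rewrite addr_eq0 => /eqP.
Qed.

Lemma degree_creation n (a : 'I_n -> R) :
  fock_degree n *m creation a = creation a *m fock_degree n + creation a.
Proof.
elim: n a => [|n IHn] a /=; first by rewrite !mulmx0 addr0.
rewrite !mulmx_block !mul0mx !mulmx0 !addr0 !add0r add_block_mx !addr0.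
rewrite mulmxN mulNmx !mulmxDl mulmxDr {}IHn !mul1mx mulmx1 scalar_mxC.
by rewrite !opprD.
Qed.

Lemma degree_vacuum n : fock_degree n *m vacuum n = 0.
Proof.
elim: n => [|n IHn] /=; first by rewrite mul0mx.
by rewrite mul_block_col !mul0mx mulmx0 addr0 IHn add0r col_mx0.
Qed.

Lemma annihilation_vacuum n (f : 'I_n -> R) : annihilation f *m vacuum n = 0.
Proof.
elim: n f => [|n IHn] f /=; first by rewrite mul0mx.
by rewrite mul_block_col !mul0mx !mulmx0 addr0 IHn add0r col_mx0.
Qed.

Lemma covacuum_vacuum n : covacuum n *m vacuum n = 1%:M.
Proof.
by elim: n => [|n IHn] /=; rewrite ?mulmx1 // mul_row_col mulmx0 addr0.
Qed.

Lemma top_coform_form n : top_coform n *m top_form n = 1%:M.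
Proof.
by elim: n => [|n IHn] /=; rewrite ?mulmx1 // mul_row_col mulmx0 add0r.
Qed.

Lemma degree_top_form n :
  fock_degree n *m top_form n = n%:R *: top_form n.
Proof.
elim: n => [|n IHn] /=; first by rewrite mul0mx scale0r.
rewrite mul_block_col !mul0mx !mulmx0 !add0r mulmxDl mul1mx IHn.
by rewrite scale_col_mx scaler0 -natr1 scalerDl scale1r.
Qed.

Hypothesis tfR : forall (x : R) m, x *+ m.+1 = 0 -> x = 0.

(** The number operator has eigenvalues 0, ..., n, and m differs from each of them by a positive
    integer, which [tfR] makes a nonzerodivisor. *)
Lemma degree_gt n m (v : 'cV[R]_(fock_dim n)) : (n < m)%N ->
  fock_degree n *m v = m%:R *: v -> v = 0.
Proof.
elim: n m v => [|n IHn] [//|m] v.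
  move=> _ /=; rewrite mul0mx => /esym/matrixP v0; apply/matrixP => i j.
  have := v0 i j; rewrite !mxE mulr_natl; exact: tfR.
rewrite ltnS -[v]vsubmxK /= mul_block_col !mul0mx addr0 add0r scale_col_mx.
move=> nm /eq_col_mx[/IHn-> //=]; last exact: ltnW.
rewrite mulmxDl mul1mx -natr1 scalerDl scale1r => /addIr/IHn-> //.
by rewrite col_mx0.
Qed.

Lemma degree_top n (v : 'cV[R]_(fock_dim n)) :
  fock_degree n *m v = n%:R *: v -> exists c, v = c *: top_form n.
Proof.
elim: n v => [|n IHn] v.
  by move=> _; exists (v 0 0); rewrite [LHS]mx11_scalar scale_scalar_mx mulr1.
rewrite -[v]vsubmxK /= mul_block_col !mul0mx addr0 add0r scale_col_mx.
move=> /eq_col_mx[/degree_gt-> //].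
rewrite mulmxDl mul1mx -natr1 scalerDl scale1r => /addIr/IHn[c ->].
by exists c; rewrite scale_col_mx scaler0.
Qed.

End Fock.

(** * Colon ideals of complete intersections *)

Section EntrywiseCongruence.
Variables (R : comNzRingType) (J : {pred R}).
Hypothesis idJ : is_ideal J.

Lemma in_ideal0 : 0 \in J. Proof. by case: idJ. Qed.
Lemma in_idealD x y : x \in J -> y \in J -> x + y \in J.
Proof. by case: idJ => _ ID _; apply: ID. Qed.
Lemma in_idealMl a x : x \in J -> a * x \in J.
Proof. by case: idJ => _ _; apply. Qed.
Lemma in_idealN x : x \in J -> - x \in J.
Proof. by rewrite -mulN1r; apply: in_idealMl. Qed.
Lemma in_idealB x y : x \in J -> y \in J -> x - y \in J.
Proof. by move=> Jx /in_idealN; apply: in_idealD. Qed.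
Lemma in_idealMr a x : x \in J -> x * a \in J.
Proof. by rewrite mulrC; apply: in_idealMl. Qed.
Lemma in_ideal_sum (K : Type) (r : seq K) (Q : pred K) (F : K -> R) :
  (forall i, Q i -> F i \in J) -> \sum_(i <- r | Q i) F i \in J.
Proof. exact: (big_ind (fun x => x \in J) in_ideal0 in_idealD). Qed.

Definition eqmx_mod r c (A B : 'M[R]_(r, c)) := forall i j, A i j - B i j \in J.

Lemma eqmod_refl r c (A : 'M[R]_(r, c)) : eqmx_mod A A.
Proof. by move=> i j; rewrite subrr in_ideal0. Qed.

Lemma eqmod_sym r c (A B : 'M[R]_(r, c)) : eqmx_mod A B -> eqmx_mod B A.
Proof. by move=> AB i j; rewrite -opprB in_idealN. Qed.

Lemma eqmod_trans r c (B A C : 'M[R]_(r, c)) :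
  eqmx_mod A B -> eqmx_mod B C -> eqmx_mod A C.
Proof.
move=> AB BC i j; have := in_idealD (AB i j) (BC i j).
by rewrite addrA subrK.
Qed.

Lemma eqmodD r c (A B A' B' : 'M[R]_(r, c)) :
  eqmx_mod A A' -> eqmx_mod B B' -> eqmx_mod (A + B) (A' + B').
Proof.
by move=> AA BB i j; rewrite !mxE opprD addrACA; apply: in_idealD.
Qed.

Lemma eqmodN r c (A B : 'M[R]_(r, c)) : eqmx_mod A B -> eqmx_mod (- A) (- B).
Proof. by move=> AB i j; rewrite !mxE -opprD in_idealN. Qed.

Lemma eqmodB r c (A B A' B' : 'M[R]_(r, c)) :
  eqmx_mod A A' -> eqmx_mod B B' -> eqmx_mod (A - B) (A' - B').
Proof. by move=> AA BB; apply/eqmodD/eqmodN. Qed.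

Lemma eqmodZ r c a (A B : 'M[R]_(r, c)) :
  eqmx_mod A B -> eqmx_mod (a *: A) (a *: B).
Proof. by move=> AB i j; rewrite !mxE -mulrBr in_idealMl. Qed.

Lemma eqmodMl r s c (C : 'M[R]_(r, s)) (A B : 'M[R]_(s, c)) :
  eqmx_mod A B -> eqmx_mod (C *m A) (C *m B).
Proof.
move=> AB i j; rewrite !mxE -sumrB.
by apply: in_ideal_sum => l _; rewrite -mulrBr in_idealMl.
Qed.

Lemma eqmodMr r s c (C : 'M[R]_(s, c)) (A B : 'M[R]_(r, s)) :
  eqmx_mod A B -> eqmx_mod (A *m C) (B *m C).
Proof.
move=> AB i j; rewrite !mxE -sumrB.
by apply: in_ideal_sum => l _; rewrite -mulrBl in_idealMr.
Qed.

End EntrywiseCongruence.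

(** The descents below use this to trade a congruence modulo J + (x) for one modulo J with an
    explicit correction term. *)
Lemma eqmod_lift (R : comNzRingType) (J J' : {pred R}) (x : R) r c
    (A B : 'M[R]_(r, c)) :
    (forall t, t \in J' -> exists q, t - x * q \in J) ->
  eqmx_mod J' A B -> exists Q, eqmx_mod J A (B + x *: Q).
Proof.
move=> JJ' AB.
have /fin_all_exists[Q hQ] (i : 'I_r) : exists q : 'I_c -> R, forall j,
    A i j - B i j - x * q j \in J.
  have /fin_all_exists[q hq] := fun j => JJ' _ (AB i j).
  by exists q.
exists (\matrix_(i, j) Q i j) => i j.
by rewrite !mxE opprD addrA.
Qed.

(** * Regular sequences expressed through another sequence *)

Section WiebeDeterminant.
Variables (R : comNzRingType) (n : nat).
Hypothesis tfR : forall (x : R) m, x *+ m.+1 = 0 -> x = 0.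
Variables (f : 'I_n -> R) (p : nat -> R) (a : nat -> 'I_n -> R).
Variable P : nat -> {pred R}.
Hypothesis pE : forall s, (s < n)%N -> p s = dotf f (a s).
Hypothesis idP : forall s, is_ideal (P s).
Hypothesis P0 : forall t, t \in P 0 -> t = 0.
Hypothesis PS : forall s, (s < n)%N -> {subset P s <= P s.+1}.
Hypothesis Pp : forall s, (s < n)%N -> p s \in P s.+1.
Hypothesis regp : forall s c, (s < n)%N -> p s * c \in P s -> c \in P s.
Hypothesis decP : forall s t, (s < n)%N -> t \in P s.+1 ->
  exists q, t - p s * q \in P s.

Let D := annihilation f.

(** The vector a_(s-1) /\ ... /\ a_0. For s = n its coefficient on the top form is, up to sign, the
    determinant of the transition matrix from f to p. *)
Fixpoint wedge s : 'cV[R]_(fock_dim n) :=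
  if s is s'.+1 then creation (a s') *m wedge s' else vacuum R n.

Lemma degree_wedge s : fock_degree R n *m wedge s = s%:R *: wedge s.
Proof.
elim: s => [|s IHs] /=; first by rewrite degree_vacuum scale0r.
rewrite mulmxA degree_creation mulmxDl -mulmxA IHs -scalemxAr.
by rewrite -natr1 scalerDl scale1r.
Qed.

(** The boundary of a wedge is a combination of the values p_j = f . a_j with j < s, all of which
    lie in P_s. *)
Lemma annihilation_wedge s : (s <= n)%N -> eqmx_mod (P s) (D *m wedge s) 0.
Proof.
elim: s => [_|s IHs ltsn] /=.
  rewrite annihilation_vacuum; exact: (eqmod_refl (idP 0)).
rewrite mulmxA annihilationK mulmxBl mul_scalar_mx -pE // -mulmxA.
rewrite -[X in eqmx_mod _ _ X]subr0; apply: (eqmodB (idP _)).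
  by move=> i j; rewrite mxE [X in _ - X]mxE subr0 (in_idealMr (idP _)) ?Pp.
rewrite -[X in eqmx_mod _ _ X](mulmx0 _ (creation (a s))).
apply: (eqmodMl (idP _)) => i j; apply: PS => //.
exact: IHs (ltnW ltsn) i j.
Qed.

(* Contracting [a_s /\ b w_s = D v + p_s t] gives [p_s (b w_s - D t) = 0] modulo
   P_s, and p_s is regular there. *)
Lemma wedge_descent b s : (s < n)%N ->
    (exists v, eqmx_mod (P s.+1) (b *: wedge s.+1) (D *m v)) ->
  exists v, eqmx_mod (P s) (b *: wedge s) (D *m v).
Proof.
move=> ltsn [v hv].
have [t ht] := eqmod_lift (fun t => @decP s t ltsn) hv.
exists t => i j; apply: (regp ltsn).
have := eqmodMl (idP s) D ht i j.
rewrite mulmxDr mulmxA annihilation_sqr mul0mx add0r -scalemxAr /=.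
rewrite [D *m (_ *m _)]mulmxA annihilationK mulmxBl mul_scalar_mx -pE // -mulmxA.
have := eqmodMl (idP s) (creation (a s)) (annihilation_wedge (ltnW ltsn)) i j.
rewrite mulmx0 -scalemxAr => h1 h2.
have := in_idealD (idP s) h2 (in_idealMl (idP s) b h1).
rewrite !mxE; congr (_ \in P s); ring.
Qed.

Lemma wiebe : exists Delta,
  (forall b, b * Delta \in P n -> exists q : 'I_n -> R, b = dotf f q) /\
  (forall j, f j * Delta \in P n).
Proof.
have [Delta wn] := degree_top tfR (degree_wedge n).
exists Delta; split=> [b bD | j].
  have: exists v, eqmx_mod (P n) (b *: wedge n) (D *m v).
    exists 0 => i j; rewrite mulmx0 wn scalerA mxE [X in _ - X]mxE subr0.
    by rewrite (in_idealMr (idP n)).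
  have /(_ n (leqnn n)) : forall s, (s <= n)%N ->
      (exists v, eqmx_mod (P s) (b *: wedge s) (D *m v)) ->
      exists v, eqmx_mod (P 0) (b *: wedge 0) (D *m v).
    elim=> // s IHs ltsn /(wedge_descent ltsn); exact: IHs (ltnW ltsn).
  move=> h /h{h} [v hv].
  have {}hv : b *: vacuum R n = D *m v.
    by apply/matrixP => i j; apply/eqP; rewrite -subr_eq0; apply/eqP/P0/hv.
  have [q hq] := covacuum_annihilation f v.
  exists q; rewrite -hq -/D -hv -scalemxAr covacuum_vacuum.
  by rewrite scale_scalar_mx mulr1 mxE eqxx.
pose d := @ord_delta R n.
have top0 : creation (d j) *m top_form R n = 0.
  apply: (degree_gt tfR (ltnSn n)).
  rewrite mulmxA degree_creation mulmxDl -mulmxA degree_top_form -scalemxAr.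
  by rewrite -natr1 scalerDl scale1r.
have := annihilation_wedge (leqnn n).
move/(eqmodMl (idP n) (creation (d j)))/(eqmodMl (idP n) (top_coform R n)).
move/(_ 0 0); rewrite !mulmx0 wn.
have -> : creation (d j) *m (D *m (Delta *: top_form R n)) = (f j * Delta) *: top_form R n.
  rewrite -!scalemxAr mulmxA -[creation _ *m _](addKr (D *m creation (d j))).
  rewrite annihilation_creation dotf_delta mulmxDl mulNmx -mulmxA top0 mulmx0.
  by rewrite oppr0 add0r mul_scalar_mx scalerA mulrC.
by rewrite -scalemxAr top_coform_form !mxE mulr1 subr0.
Qed.

End WiebeDeterminant.

(** * Almost complete intersections are not Gorenstein *)

Section GulliksenDescent.
Variables (R : comNzRingType) (n : nat).
Hypothesis tfR : forall (x : R) m, x *+ m.+1 = 0 -> x = 0.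
Variables (J I mx : {pred R}) (f g : R) (x y : 'I_n -> R) (u : 'I_n -> 'I_n -> R).
Hypotheses (idJ : is_ideal J) (idI : is_ideal I) (idm : is_ideal mx).
Hypothesis xm : forall i, x i \in mx.
Hypothesis Im : {subset I <= mx}.
Hypothesis natm : forall q, q.+1%:R \notin mx.
Hypothesis gE : g = dotf x y.
Hypothesis decI : forall t, t \in I -> exists q, t - f * q \in J.
Hypothesis colon_g : forall t, g * t \in J -> t \in I.
Hypothesis colon_f : forall t, f * t \in J -> exists q, t - g * q \in J.
Hypothesis uE : forall i,
  \sum_k x k * u k i - dotf x (u i) - f * y i \in J.

Let D := annihilation x.
Let Y := creation y.
(** W is a 2-vector with Koszul boundary f Y modulo J, while Y has boundary g. Its plain powers
    replace the divided powers of Tate's variable, so positive integer factors are carried along. *)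
Let W := \sum_k creation (@ord_delta R n k) *m creation (u k).

Lemma comm_WY : W *m Y = Y *m W.
Proof.
rewrite mulmx_suml mulmx_sumr; apply: eq_bigr => k _.
rewrite -mulmxA [creation (u k) *m _]creation_anticomm mulmxN !mulmxA.
by rewrite [creation _ *m Y]creation_anticomm mulNmx opprK.
Qed.

Lemma degree_W : fock_degree R n *m W = W *m fock_degree R n + W *+ 2.
Proof.
rewrite mulmx_suml mulmx_sumr -sumrMnl -big_split; apply: eq_bigr => k _ /=.
rewrite mulmxA degree_creation mulmxDl -!mulmxA degree_creation mulmxDr.
by rewrite mulr2n addrA.
Qed.

(** W has even degree, so moving D past it leaves exactly the wedge product with the boundary of
    W. *)
Lemma bracket_DW : D *m W = W *m D +
  creation (fun i => \sum_k x k * u k i - dotf x (u i)).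
Proof.
have -> : creation (fun i => \sum_k x k * u k i - dotf x (u i)) =
    \sum_k x k *: creation (u k) - \sum_k dotf x (u k) *: creation (@ord_delta R n k).
  rewrite -creation_delta -creation_sum -scaleN1r addrC -creation_linear.
  by congr creation; apply: funext => i; rewrite mulN1r addrC.
rewrite mulmx_suml mulmx_sumr addrA -[_ + \sum_k _ *: _]big_split /= -sumrB.
apply: eq_bigr => k _.
rewrite mulmxA annihilationK mulmxBl dotf_delta mul_scalar_mx -!mulmxA.
rewrite annihilationK mulmxBr mul_mx_scalar opprB addrA; congr (_ - _).
exact: addrC.
Qed.

Lemma bracket_DW_mod : eqmx_mod J (D *m W) (W *m D + f *: Y).
Proof.
rewrite bracket_DW; apply: (eqmodD idJ); first exact: eqmod_refl.
rewrite [X in eqmx_mod _ X _]creation_delta.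
rewrite [X in eqmx_mod _ _ (_ *: X)]creation_delta scaler_sumr => i j.
rewrite !summxE -sumrB; apply: (in_ideal_sum idJ) => l _.
by rewrite !mxE mulrA -mulrBl (in_idealMr idJ).
Qed.

Fixpoint Wpow N : 'cV[R]_(fock_dim n) :=
  if N is N'.+1 then W *m Wpow N' else vacuum R n.

Lemma YWpow N : Y *m (W *m Wpow N) = W *m (Y *m Wpow N).
Proof. by rewrite !mulmxA comm_WY. Qed.

(** D acts as a derivation on the powers of the even element W, each factor contributing f Y modulo
    J. *)
Lemma D_Wpow N :
  eqmx_mod J (D *m Wpow N.+1) (N.+1%:R *: (f *: (Y *m Wpow N))).
Proof.
have step M : eqmx_mod J (D *m Wpow M.+1) (W *m (D *m Wpow M) + f *: (Y *m Wpow M)).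
  by rewrite /= !mulmxA scalemxAl -mulmxDl; apply: eqmodMr bracket_DW_mod.
elim: N => [|N IHN].
  have := step 0; rewrite /= annihilation_vacuum mulmx0 add0r scale1r; exact.
apply: eqmod_trans (step _) _ => //.
rewrite -natr1 scalerDl scale1r; apply: eqmodD => //; last exact: eqmod_refl.
by have := eqmodMl idJ W IHN; rewrite -!scalemxAr [Wpow N.+1]/= YWpow.
Qed.

(** The other term of the Leibniz rule, - Y D(W^N), is modulo J a multiple of Y Y = 0. *)
Lemma D_Y_Wpow N : eqmx_mod J (D *m (Y *m Wpow N)) (g *: Wpow N).
Proof.
rewrite mulmxA annihilationK -gE mulmxBl mul_scalar_mx -mulmxA -/Y.
rewrite -[X in eqmx_mod _ _ X]subr0; apply: eqmodB => //; first exact: eqmod_refl.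
case: N => [|N]; first by rewrite /= annihilation_vacuum mulmx0; apply: eqmod_refl.
have := eqmodMl idJ Y (D_Wpow N).
by rewrite -!scalemxAr [Y *m (Y *m _)]mulmxA creation_sqr mul0mx !scaler0.
Qed.

(** W^N has degree 2N, which exceeds n. *)
Lemma Wpow_eq0 N : (n < N)%N -> Wpow N = 0.
Proof.
move=> ltnN; apply: (degree_gt tfR (leq_trans ltnN (leq_addl N N))).
elim: N {ltnN} => [|N IHN] /=; first by rewrite degree_vacuum scale0r.
rewrite mulmxA degree_W mulmxDl -mulmxA IHN -scalemxAr -scaler_nat -scalemxAl.
by rewrite -scalerDl -natrD addn2 addSn addnS.
Qed.

(* Apply D to [q W^(N+1) = D v + f t], cancel f modulo g, apply D again, and
   cancel g: this undoes one divided power of the degree two Tate variable that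
   kills the Koszul homology of (J, f). *)
Lemma Wpow_descent q N :
    (exists v, eqmx_mod I (q.+1%:R *: Wpow N.+1) (D *m v)) ->
  exists q' v, eqmx_mod I (q'.+1%:R *: Wpow N) (D *m v).
Proof.
case=> v hv; exists (q.+1 * N.+1).-1; rewrite prednK // natrM.
have [t ht] := eqmod_lift decI hv.
have [v' hv'] : exists v', eqmx_mod J
    (q.+1%:R *: (N.+1%:R *: (Y *m Wpow N))) (D *m t + g *: v').
  have fP c d (A B : 'M[R]_(c, d)) :
      eqmx_mod J (f *: A) (f *: B) -> exists C, eqmx_mod J A (B + g *: C).
    move=> fAB; apply: (@eqmod_lift _ J [pred t | f * t \in J] g _ _ A B colon_f).
    by move=> i j; have := fAB i j; rewrite !mxE -mulrBr.
  apply: fP; have := eqmodMl idJ D ht.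
  rewrite mulmxDr mulmxA annihilation_sqr mul0mx add0r -!scalemxAr.
  apply: eqmod_trans => //; apply: eqmod_sym => //.
  have := eqmodZ idJ q.+1%:R (D_Wpow N).
  rewrite !scalerA; suff -> : f * q.+1%:R * N.+1%:R = q.+1%:R * N.+1%:R * f by [].
  ring.
exists v' => i j; apply: colon_g.
have := eqmodMl idJ D hv' i j.
rewrite mulmxDr mulmxA annihilation_sqr mul0mx add0r -!scalemxAr => h1.
have := eqmodZ idJ (q.+1%:R * N.+1%:R) (D_Y_Wpow N) i j; rewrite -scalerA => h2.
have := in_idealB idJ h1 h2.
rewrite !mxE; congr (_ \in J); ring.
Qed.

(** W^(n+1) = 0 is a boundary modulo I. Descending to W^0, some positive integer is congruent modulo
    I to a combination of the x_i, hence lies in [mx], against [natm]. *)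
Lemma gulliksen_descent : False.
Proof.
have h N : (exists q v, eqmx_mod I (q.+1%:R *: Wpow N) (D *m v)) ->
    exists q v, eqmx_mod I (q.+1%:R *: Wpow 0) (D *m v).
  by elim: N => // N IHN [q /Wpow_descent].
have [|q [v /(eqmodMl idI (covacuum R n))/(_ 0 0)]] := h n.+1.
  exists 0%N, 0; rewrite Wpow_eq0 // scaler0 mulmx0; exact: eqmod_refl.
rewrite -scalemxAr covacuum_vacuum; have [c ->] := covacuum_annihilation x v.
rewrite !mxE mulr1 => /Im qm; have := natm q; rewrite -(subrK (dotf x c) q.+1%:R).
case/negP; apply: in_idealD => //; apply: in_ideal_sum => // i _.
by rewrite (in_idealMr idm).
Qed.

End GulliksenDescent.

(** * Functionals and self-injectivity *)

Section Functionals.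
Variables (k : fieldType) (A : comPzRingType) (iota : k -> A).
Hypothesis iotaD : {morph iota : a b / a + b}.
Hypothesis iotaM : {morph iota : a b / a * b}.
Hypothesis iota1 : iota 1 = 1.

(** Modules over A are k-spaces through [iota]; linearity as a predicate avoids a second module
    structure on them. *)
Definition klinear (N : lmodType A) (psi : N -> k) :=
  forall c x y, psi (iota c *: x + y) = c * psi x + psi y.

Definition kclosed (N : lmodType A) (U : N -> Prop) :=
  forall c x y, U x -> U y -> U (iota c *: x + y).

Lemma iota0 : iota 0 = 0.
Proof. by apply: (@addrI _ (iota 0)); rewrite -iotaD !addr0. Qed.
Lemma iotaN c : iota (- c) = - iota c.
Proof. by apply: (@addrI _ (iota c)); rewrite -iotaD !subrr iota0. Qed.

Section Theory.
Variable N : lmodType A.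

Lemma klinear0 (psi : N -> k) : klinear psi -> psi 0 = 0.
Proof.
move=> lin; have := lin 1 0 0; rewrite iota1 scale1r addr0 mul1r => /eqP.
by rewrite -subr_eq0 opprD addrA subrr add0r oppr_eq0 => /eqP.
Qed.
Lemma klinearD (psi : N -> k) : klinear psi -> {morph psi : x y / x + y}.
Proof. by move=> lin x y; have := lin 1 x y; rewrite iota1 scale1r mul1r. Qed.
Lemma klinearZ (psi : N -> k) c x : klinear psi -> psi (iota c *: x) = c * psi x.
Proof. by move=> lin; rewrite -[_ *: _]addr0 lin klinear0 ?addr0. Qed.
Lemma klinearN (psi : N -> k) : klinear psi -> {morph psi : x / - x}.
Proof.
by move=> lin x; rewrite -scaleN1r -iota1 -iotaN klinearZ // mulN1r.
Qed.
Lemma klinear_sum (psi : N -> k) (K : Type) (r : seq K) (F : K -> N) :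
  klinear psi -> psi (\sum_(i <- r) F i) = \sum_(i <- r) psi (F i).
Proof.
move=> lin; elim: r => [|i r IHr]; first by rewrite !big_nil klinear0.
by rewrite !big_cons klinearD // IHr.
Qed.

(* A maximal subspace avoiding u0 is a hyperplane. *)
Lemma functional_separation (U : N -> Prop) (u0 : N) :
    kclosed U -> U 0 -> ~ U u0 ->
  exists psi, [/\ klinear psi, forall x, U x -> psi x = 0 & psi u0 = 1].
Proof.
move=> clU U0 Nu0.
(* Stability under adding U, instead of containing U, holds for the empty set too, which is the
   union of the empty chain; maximality then puts 0, and so U, into [A0]. *)
pose P H := [/\ kclosed H, forall x y, H x -> U y -> H (x + y) & ~ H u0].
have [|A0 [[clA UA NA] maxA]] := @classical_sets.Zorn_bigcup N P.
  move=> F FP tot; split.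
  - move=> c x y [X FX Xx] [X' FX' X'y].
    have [XX'|X'X] := tot _ _ FX FX'.
      by exists X' => //; have [cl _ _] := FP _ FX'; apply: cl => //; apply: XX'.
    by exists X => //; have [cl _ _] := FP _ FX; apply: cl => //; apply: X'X.
  - move=> x y [X FX Xx] Uy; exists X => //.
    by have [_ UX _] := FP _ FX; apply: UX.
  - by case=> X FX; have [_ _] := FP _ FX.
have A0_0 : A0 0.
  apply: contrapT => nA0; apply: (maxA U).
    split=> [x Ax|UsubA]; last by apply/nA0/UsubA.
    case: nA0; have := clA (-1) x x Ax Ax.
    by rewrite iotaN iota1 scaleN1r addNr.
  split=> // x y Ux Uy; have := clU 1 x y Ux Uy.
  by rewrite iota1 scale1r.
have subA x : U x -> A0 x by move=> Ux; rewrite -[x]add0r; apply: UA.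
have clAZ c x : A0 x -> A0 (iota c *: x).
  by move=> Ax; rewrite -[_ *: _]addr0; apply: clA.
have clAD x y : A0 x -> A0 y -> A0 (x + y).
  by move=> Ax Ay; have := clA 1 x y Ax Ay; rewrite iota1 scale1r.
(* If x is outside [A0], then [A0] together with the line of x reaches u0 by maximality; solving for
   x gives c. *)
have ex x : exists c, A0 (x - iota c *: u0).
  have [Ax|nAx] := pselect (A0 x).
    by exists 0; rewrite iota0 scale0r subr0.
  pose B z := exists c, A0 (z - iota c *: x).
  have BsupA : classical_sets.proper A0 B.
    split=> [a Aa|BA]; first by exists 0; rewrite iota0 scale0r subr0.
    by apply/nAx/BA; exists 1; rewrite iota1 scale1r subrr.
  have [c Ac] : B u0.
    apply: contrapT => nB; apply: (maxA B BsupA); split=> //.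
      move=> c y z [d Ad] [e Ae]; exists (c * d + e).
      have := clA c _ _ Ad Ae.
      by rewrite scalerBr addrACA -opprD iotaD iotaM scalerDl scalerA.
    move=> y z [d Ad] Uz; exists d; rewrite addrAC; exact: UA.
  have c0 : c != 0.
    by apply: contra_notN NA => /eqP c0; rewrite c0 iota0 scale0r subr0 in Ac.
  exists c^-1; have := clAZ (- c^-1) _ Ac.
  rewrite scalerBr scalerA -iotaM mulNr mulVf // !iotaN iota1 scaleN1r opprK.
  by rewrite scaleNr addrC.
have uniq x c d : A0 (x - iota c *: u0) -> A0 (x - iota d *: u0) -> c = d.
  move=> Ac Ad; apply/eqP; rewrite -subr_eq0; apply: contra_notT NA; rewrite subr_eq0 => cd.
  have := clA (-1) _ _ Ac Ad.
  rewrite iotaN iota1 scaleN1r opprB subrKA -scaleNr -iotaN -scalerDl -iotaD.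
  move/(clAZ (c - d)^-1); rewrite scalerA -iotaM.
  by rewrite mulVf ?iota1 ?scale1r // subr_eq0.
pose psi x := sval (cid (ex x)).
have psiP x : A0 (x - iota (psi x) *: u0) by rewrite /psi; case: cid.
exists psi; split=> [c x y|x Ux|].
- apply: (uniq _ _ _ (psiP _)).
  have := clA c _ _ (psiP x) (psiP y).
  by rewrite scalerBr addrACA -opprD iotaD iotaM scalerDl scalerA.
- by apply: (uniq _ _ _ (psiP _)); rewrite iota0 scale0r subr0; apply: subA.
- by apply: (uniq _ _ _ (psiP _)); rewrite iota1 scale1r subrr.
Qed.

End Theory.

(** Choose m0 with psi m0 = 1 and separate its image from the image of the kernel of psi; kernel and
    m0 span M. *)
Lemma functional_extension (M N : lmodType A) (i : {linear M -> N}) (psi : M -> k) :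
    injective i -> klinear psi ->
  exists psi' : N -> k, klinear psi' /\ forall x, psi' (i x) = psi x.
Proof.
move=> inj_i lin.
have [all0|nz] := pselect (forall x, psi x = 0).
  by exists (fun=> 0); split=> // c x y; rewrite mulr0 addr0.
have [m1 nz1] : exists m, psi m != 0.
  apply: contrapT => no; apply: nz => x.
  by have [//|xn0] := eqVneq (psi x) 0; case: no; exists x.
pose m0 := iota (psi m1)^-1 *: m1.
have psi0 : psi m0 = 1 by rewrite /m0 klinearZ // mulVf.
pose U y := exists2 x, y = i x & psi x = 0.
have [||| psi' [lin' psi'U psi'1]] := @functional_separation N U (i m0).
- move=> c _ _ [x -> x0] [y -> y0]; exists (iota c *: x + y).
    by rewrite linearP.
  by rewrite lin x0 y0 mulr0 addr0.
- by exists 0; rewrite ?linear0 ?klinear0.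
- by case=> x /inj_i <- /eqP; rewrite psi0 oner_eq0.
exists psi'; split=> // x.
have /psi'U : U (i (x - iota (psi x) *: m0)).
  exists (x - iota (psi x) *: m0) => //.
  by rewrite klinearD // klinearN // klinearZ // psi0 mulr1 subrr.
rewrite linearB linearZ /= klinearD // klinearN // klinearZ // psi'1 mulr1.
by move/eqP; rewrite subr_eq0 => /eqP.
Qed.

(* A nondegenerate functional representing every other one makes the ring
   injective: composing with it turns maps into the ring into scalar-valued
   maps, which extend. *)
Lemma frobenius_injective (phi : A^o -> k) :
    klinear phi -> (forall a, (forall b, phi (a * b) = 0) -> a = 0) ->
    (forall psi : A^o -> k, klinear psi -> exists a, forall b, psi b = phi (a * b)) ->
  injective_module (A^o : lmodType A).
Proof.
move=> lin nondeg rep M N i g inj_i.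
have linpg : klinear (fun x => phi (g x)) by move=> c x y /=; rewrite linearP lin.
have [psi [linpsi psiE]] := functional_extension inj_i linpg.
have ex x : exists a, forall b, psi (b *: x) = phi (a * b).
  apply: (rep (fun b => psi (b *: x))) => c y z.
  by rewrite scalerDl -[iota c *: y]/(iota c * (y : A)) -scalerA linpsi.
pose h x : A^o := sval (cid (ex x)).
have hP x b : psi (b *: x) = phi (h x * b) by rewrite /h; case: cid.
have uniq a a' : (forall b, phi (a * b) = phi (a' * b)) -> a = a'.
  move=> aa'; apply/eqP; rewrite -subr_eq0; apply/eqP/nondeg => b.
  by rewrite mulrBl (klinearD lin) (klinearN lin) aa' subrr.
have linh : linear h.
  move=> c x y; apply: uniq => b; rewrite -hP scalerDr scalerA klinearD // !hP.
  rewrite mulrDl (klinearD lin) -[c *: h x]/(c * (h x : A)); congr (phi _ + _).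
  by rewrite [b * c]mulrC mulrCA mulrA.
pose hL : {linear N -> A^o} := HB.pack h (GRing.isLinear.Build _ _ _ _ h linh).
exists hL => x /=; apply: uniq => b.
by rewrite -hP -linearZ psiE linearZ /= mulrC.
Qed.

End Functionals.

(** * Finite injective dimension *)

Section IdealModule.
Variables (A : comPzRingType) (B : {pred A}) (idB : is_ideal B).

(** The proof is an argument so that the submodule structure can be attached to the predicate. *)
Definition ideal_pred of is_ideal B : {pred A^o} := B.

Fact ideal_pred_submod : submod_closed (ideal_pred idB).
Proof.
have [B0 BD BM] := idB; split=> // a x y Bx By.
by apply: BD => //; apply: BM.
Qed.
HB.instance Definition _ :=
  GRing.isSubmodClosed.Build A A^o (ideal_pred idB) ideal_pred_submod.

Record ideal_module := IdealModule { ideal_val : A^o; _ : ideal_val \in ideal_pred idB }.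
HB.instance Definition _ := [isSub for ideal_val].
HB.instance Definition _ := [Choice of ideal_module by <:].
HB.instance Definition _ := [SubChoice_isSubLmodule of ideal_module by <:].

End IdealModule.

(** Otherwise every counterexample has a strictly larger one, and iterated choice gives a chain that
    never stabilizes. *)
Lemma noetherian_ideal_ind (A : comPzRingType) (Q : {pred A} -> Prop) :
    noetherian_ring A ->
    (forall I, is_ideal I ->
       (forall J, is_ideal J -> {subset I <= J} -> ~ {subset J <= I} -> Q J) -> Q I) ->
  forall I, is_ideal I -> Q I.
Proof.
move=> noethA ind I idI; apply: contrapT => nQI.
pose T := {J : {pred A} | is_ideal J /\ ~ Q J}.
have next (J : T) : exists K : T, {subset sval J <= sval K} /\ ~ {subset sval K <= sval J}.
  case: J => J [idJ nQJ] /=; apply: contrapT => no; apply: nQJ; apply: ind => // K idK JK KJ.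
  by apply: contrapT => nQK; apply: no; exists (exist _ K (conj idK nQK)).
have [F hF] := choice next.
pose chain i := sval (iter i F (exist _ I (conj idI nQI))).
have [j|j|N hN] := noethA chain.
- by rewrite /chain; case: (iter _ _ _) => J [].
- by case: (hF (iter j F (exist _ I (conj idI nQI)))).
case: (hF (iter N F (exist _ I (conj idI nQI)))) => _; apply=> x.
by rewrite -[iter N _ _]/(iter N _ _) -/(chain N) -(hN N.+1).
Qed.

Section FiniteInjectiveDimension.
Variables (A : comPzRingType) (mA : {pred A}).
Hypothesis unit_out : forall a, a \notin mA -> exists b, b * a = 1.
Hypothesis socle_ex : forall I, is_ideal I -> 1 \notin I ->
  exists t, t \notin I /\ forall a, a \in mA -> a * t \in I.
Hypothesis noethA : noetherian_ring A.

(** Map I + (t) to E by sending i + a t to a e. This is well defined: if a t is in I then a is not a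
    unit, so a is in [mA] and kills e. Extend to A and let e' be the image of 1. *)
Lemma injective_divide (E : lmodType A) (I : {pred A}) t (e : E) :
    injective_module E -> is_ideal I -> t \notin I ->
    (forall a, a \in mA -> a * t \in I) -> (forall a, a \in mA -> a *: e = 0) ->
  exists e', t *: e' = e /\ forall a, a \in I -> a *: e' = 0.
Proof.
move=> injE [I0 ID IM] It mt me.
pose B : {pred A} := fun x => `[< exists a, x - a * t \in I >].
have idB : is_ideal B.
  split=> [|x y /asboolP[a ha] /asboolP[b hb]|c x /asboolP[a ha]]; apply/asboolP.
  - by exists 0; rewrite mul0r subr0.
  - by exists (a + b); rewrite mulrDl opprD addrACA ID.
  - by exists (c * a); rewrite -mulrA -mulrBr IM.
have kill a : a * t \in I -> a *: e = 0.
  move=> at_I; apply: me; apply: contraNT It => /unit_out[b ba].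
  by rewrite -[t]mul1r -ba -mulrA IM.
have ex (x : ideal_module idB) : exists a, ideal_val x - a * t \in I.
  by case: x => x /= /asboolP.
pose c x := sval (cid (ex x)).
have cP x : ideal_val x - c x * t \in I by rewrite /c; case: cid.
have uniq a x : ideal_val x - a * t \in I -> a *: e = c x *: e.
  move=> ha; apply/eqP; rewrite -subr_eq0 -scalerBl; apply/eqP/kill.
  rewrite mulrBl; have := ID _ _ (cP x) (IM (-1) _ ha).
  rewrite mulN1r opprB addrC subrKA; exact.
have ling : linear (fun x : ideal_module idB => c x *: e).
  move=> d x y; rewrite scalerA -scalerDl; apply/esym/uniq.
  rewrite mulrDl opprD addrACA -mulrA; apply: ID; last exact: cP.
  by have := IM d _ (cP x); rewrite mulrBr linearZ.
pose g : {linear ideal_module idB -> E} :=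
  HB.pack (fun x : ideal_module idB => c x *: e)
    (GRing.isLinear.Build _ _ _ _ (fun x : ideal_module idB => c x *: e) ling).
have [h hE] := injE _ _ (val : {linear ideal_module idB -> A^o}) g val_inj.
have hx x (Bx : x \in B) : x *: h 1 = c (IdealModule (Bx : x \in ideal_pred idB)) *: e.
  rewrite -[RHS](hE (IdealModule (Bx : x \in ideal_pred idB))) -linearZ /=.
  congr (h _); exact: (mulr1 (x : A)).
exists (h 1); split.
  have Bt : t \in B by apply/asboolP; exists 1; rewrite mul1r subrr.
  by rewrite (hx _ Bt) -[RHS]scale1r; apply/esym/uniq; rewrite /= mul1r subrr.
move=> a Ia; have Ba : a \in B by apply/asboolP; exists 0; rewrite mul0r subr0.
by rewrite (hx _ Ba) -[RHS](scale0r e); apply/esym/uniq; rewrite /= mul0r subr0.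
Qed.

Section Resolution.
Variables (E : nat -> lmodType A) (delta : forall i, {linear E i -> E i.+1}).
Hypothesis injE : forall i, injective_module (E i).
Hypothesis exactE : forall i y, delta i.+1 y = 0 <-> exists x, y = delta i x.
Variable s : A.
Hypothesis s_neq0 : s != 0.
Hypothesis s_socle : forall a, a \in mA -> a * s = 0.

(** For Z the kernel of [delta i], this says that maps from the ideal (s) to Z extend to A. *)
Definition socle_divisible i := forall c : E i, delta i c = 0 ->
  (forall a, a \in mA -> a *: c = 0) ->
  exists c1, delta i c1 = 0 /\ s *: c1 = c.

(** With exactness, this is the vanishing of Ext^1(A/I, ker [delta i]). *)
Definition annihilator_lifting i (I : {pred A}) :=
  forall c : E i.+1, delta i.+1 c = 0 -> (forall a, a \in I -> a *: c = 0) ->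
  exists e, delta i e = c /\ forall a, a \in I -> a *: e = 0.

Lemma delta_delta i x : delta i.+1 (delta i x) = 0.
Proof. by apply/exactE; exists x. Qed.

(** Noetherian induction on I. For t in the socle modulo I, t c is a socle element, so t c = s c1
    with c1 the image of some e1. Dividing s e1 as t e2 with I e2 = 0 makes c minus the image of e2
    vanish under the larger ideal I + (t). *)
Lemma divisible_lifting i I :
  socle_divisible i.+1 -> is_ideal I -> annihilator_lifting i I.
Proof.
move=> divS; move: I; apply: noetherian_ideal_ind => // I idI IH c dc Ic.
have [I1|nI1] := boolP (1 \in I).
  by exists 0; split=> [|a _]; rewrite ?scaler0 // linear0 -(Ic _ I1) scale1r.
have [t [nIt mt]] := socle_ex idI nI1; have [I0 ID IM] := idI.
have [||c1 [dc1 sc1]] := divS (t *: c).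
- by rewrite linearZ /= dc scaler0.
- by move=> a ma; rewrite scalerA; apply/Ic/mt.
have /exactE[e1 c1E] := dc1.
have [|e2 [te2 Ie2]] := injective_divide (e := s *: e1) (@injE i) idI nIt mt.
  by move=> a ma; rewrite scalerA s_socle // scale0r.
pose B : {pred A} := fun x => `[< exists b, x - b * t \in I >].
have [|||||e3 [de3 Be3]] := IH B _ _ _ (c - delta i e2).
- split=> [|x y /asboolP[a ha] /asboolP[b hb]|d x /asboolP[a ha]]; apply/asboolP.
  + by exists 0; rewrite mul0r subr0.
  + by exists (a + b); rewrite mulrDl opprD addrACA ID.
  + by exists (d * a); rewrite -mulrA -mulrBr IM.
- by move=> x Ix; apply/asboolP; exists 0; rewrite mul0r subr0.
- move=> BI; case/negP: nIt; apply: BI; apply/asboolP; exists 1.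
  by rewrite mul1r subrr.
- by rewrite linearB dc delta_delta subrr.
- move=> a /asboolP[b hb]; rewrite -(subrK (b * t) a) scalerDl.
  rewrite scalerBr Ic // -linearZ_LR Ie2 // linear0 subr0 add0r -scalerA scalerBr.
  by rewrite -linearZ_LR te2 linearZ_LR -c1E sc1 subrr scaler0.
exists (e2 + e3); split=> [|a Ia]; first by rewrite linearD de3 addrC subrK.
rewrite scalerDr Ie2 // Be3 ?addr0 //.
by apply/asboolP; exists 0; rewrite mul0r subr0.
Qed.

(** Write c = s e in the injective module. The image of e is a cocycle killed by s, so it lifts to
    some e3 killed by s, and e - e3 is the required cocycle. *)
Lemma divisible_step i : socle_divisible i.+1 -> socle_divisible i.
Proof.
move=> /divisible_lifting lift c dc mc.
have id0 : is_ideal (pred1 (0 : A)).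
  split=> [|x y /eqP-> /eqP->|a x /eqP->]; rewrite !inE ?addr0 ?mulr0 //.
have [||e [se _]] := injective_divide (e := c) (@injE i) id0 s_neq0.
- by move=> a ma; rewrite inE s_socle.
- exact: mc.
pose B : {pred A} := fun x => `[< exists a, x = a * s >].
have [|||e3 [de3 Be3]] := lift B _ (delta i e).
- split=> [|x y /asboolP[a ->] /asboolP[b ->]|d x /asboolP[a ->]]; apply/asboolP.
  + by exists 0; rewrite mul0r.
  + by exists (a + b); rewrite mulrDl.
  + by exists (d * a); rewrite mulrA.
- exact: delta_delta.
- by move=> _ /asboolP[a ->]; rewrite -scalerA -[s *: delta i e]linearZ_LR se dc scaler0.
exists (e - e3); split; first by rewrite linearB de3 subrr.
rewrite scalerBr se Be3 ?subr0 //.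
by apply/asboolP; exists 1; rewrite mul1r.
Qed.

End Resolution.

(* Dimension shifting: over an Artinian local ring, a module embedded in an
   injective module with injective cokernel is itself injective; here only the
   extension of maps from the socle is tracked. *)
Lemma finite_injdim_socle d : (1 : A) != 0 -> inj_dim_le (A^o : lmodType A) d ->
  exists s, [/\ s != 0, forall a, a \in mA -> a * s = 0 &
    forall u, (forall a, a \in mA -> a * u = 0) -> exists c, u = c * s].
Proof.
move=> nz1 [E [eta [delta [injE inj_eta ker0 exactE zeroE]]]].
have id0 : is_ideal (pred1 (0 : A)).
  split=> [|x y /eqP-> /eqP->|a x /eqP->]; rewrite !inE ?addr0 ?mulr0 //.
have [s [ns ms]] := socle_ex id0 nz1.
have s0 : s != 0 by [].
have {}ms a : a \in mA -> a * s = 0 by move/ms/eqP.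
exists s; split=> // u mu.
have div0 : socle_divisible delta s 0.
  (* The descent starts at d + 1, where the module is zero. *)
  have : socle_divisible delta s d.+1.
    move=> c _ _; exists 0; split; first exact: linear0.
    by rewrite scaler0; apply/esym/(zeroE d.+1).
  by elim: d.+1 => // i IHi /(divisible_step injE exactE s0 ms)/IHi.
have [||c1 [dc1 sc1]] := div0 (eta u).
- by apply/ker0; exists u.
- by move=> a ma; rewrite -linearZ_LR (mu a ma : a *: (u : A^o) = 0) linear0.
have /ker0[v c1E] := dc1; exists v.
by apply: inj_eta; rewrite -sc1 c1E -linearZ_LR mulrC.
Qed.

End FiniteInjectiveDimension.

(** * Monomial complete intersections *)

Section BoxIdeals.
Variables (n : nat) (k : fieldType).
Hypothesis char0 : [pchar k] =i pred0.
Local Notation R := (mpseries n k).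
Implicit Types (m : 'X_{1..n}) (t : R).

Lemma natf0 q : (q.+1%:R : k) != 0.
Proof. by have /pcharf0P-> := char0. Qed.

Lemma mps_torsion_free t q : t *+ q.+1 = 0 -> t = 0.
Proof.
move=> tq0; apply/mpsP => m; have /mpsP/(_ m) := tq0.
by rewrite mpsMn -mulr_natr => /eqP; rewrite mulf_eq0 (negPf (natf0 q)) orbF => /eqP.
Qed.

Lemma lem_mulm1 i M m : (U_(i) *+ M <= m)%MM = (M <= m i)%N.
Proof.
apply/mnm_lepP/idP => [/(_ i)|leM j]; rewrite mulmnE mnm1E ?eqxx ?mul1n //.
by case: (i =P j) => [<-|_]; rewrite ?mul1n ?mul0n.
Qed.

(* The ideal (x_0^M, ..., x_(s-1)^M). *)
Definition box_ideal M s : {pred R} := fun t =>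
  `[< forall m, (forall i : 'I_n, (i < s)%N -> (m i < M)%N) -> t m = 0 >].

Lemma box_idealP M s t : reflect
  (forall m, (forall i : 'I_n, (i < s)%N -> (m i < M)%N) -> t m = 0)
  (t \in box_ideal M s).
Proof. exact: asboolP. Qed.

Lemma box_ideal_is_ideal M s : is_ideal (box_ideal M s).
Proof.
split=> [|x y /box_idealP hx /box_idealP hy|a x /box_idealP hx];
  apply/box_idealP => m hm //.
  by rewrite mpsD hx ?hy ?addr0.
rewrite [LHS]big1 // => -[u v] /= /eqP mE; rewrite [x _]hx ?mulr0 // => i lt_is.
apply: leq_ltn_trans (hm i lt_is).
by move/(congr1 (fun w : 'X_{1..n} => w i)): mE => ->; rewrite mnmDE leq_addl.
Qed.

Lemma box_ideal0 M t : t \in box_ideal M 0 -> t = 0.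
Proof. by move/box_idealP=> h; apply/mpsP => m; rewrite h. Qed.

Lemma box_ideal_sub M s s' : (s <= s')%N ->
  {subset box_ideal M s <= box_ideal M s'}.
Proof.
move=> le_s t /box_idealP h; apply/box_idealP => m hm; apply: h => i lt_is.
exact/hm/(leq_trans lt_is).
Qed.

Lemma mpsX_box M s (i : 'I_n) : (i < s)%N -> mpsX k i ^+ M \in box_ideal M s.
Proof.
move=> lt_is; apply/box_idealP => m /(_ i lt_is) ltM; rewrite mpsX_exp /=.
case: eqP ltM => // ->; rewrite mulmnE mnm1E eqxx mul1n.
by rewrite ltnn.
Qed.

Lemma box_regular M (i : 'I_n) t :
  mpsX k i ^+ M * t \in box_ideal M i -> t \in box_ideal M i.
Proof.
move=> /box_idealP h; apply/box_idealP => m hm.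
rewrite -(h (U_(i) *+ M + m)%MM) ?mpsX_exp ?mpsXmM // => j lt_ji.
rewrite mnmDE mulmnE mnm1E; case: (i =P j) lt_ji => [->|_ lt_ji]; first by rewrite ltnn.
by rewrite mul0n; apply: hm.
Qed.

Lemma box_decS M (i : 'I_n) t : t \in box_ideal M i.+1 ->
  exists q, t - mpsX k i ^+ M * q \in box_ideal M i.
Proof.
move=> /box_idealP h; exists (MPSeries (fun m => t (U_(i) *+ M + m)%MM)).
apply/box_idealP => m hm; rewrite mpsD mpsN mpsX_exp.
have [leM|ltM] := leqP M (m i).
  have le : (U_(i) *+ M <= m)%MM by rewrite lem_mulm1.
  by rewrite -(submK le) (addmC (m - _)%MM) mpsXmM /= subrr.
rewrite mpsXmM0 ?subr0; last by rewrite lem_mulm1 -ltnNge.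
apply: h => j; rewrite ltnS leq_eqVlt => /orP[/eqP/val_inj->//|]; exact: hm.
Qed.

(** The vanishing of [q] from s on is what the induction in [koszul_degree1] consumes. *)
Lemma box_dec M s t : (s <= n)%N -> t \in box_ideal M s ->
  exists2 q : 'I_n -> R, (forall i : 'I_n, (s <= i)%N -> q i = 0) &
    t = \sum_i mpsX k i ^+ M * q i.
Proof.
elim: s t => [|s IHs] t.
  by move=> _ /box_ideal0->; exists (fun=> 0) => //; rewrite big1 // => i; rewrite mulr0.
move=> ltsn; pose i0 := Ordinal ltsn.
move=> /(@box_decS M i0)[q /(IHs _ (ltnW ltsn))[r r0 /eqP]].
rewrite subr_eq => /eqP->; exists (fun i => r i + (i == i0)%:R * q).
  move=> i lt_si; rewrite r0 ?(ltnW lt_si) // add0r.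
  by case: (i =P i0) lt_si => [->|]; rewrite ?ltnn // mul0r.
under [RHS]eq_bigr do rewrite mulrDr.
rewrite big_split /=; congr (_ + _); rewrite (bigD1 i0) //= eqxx mul1r big1 ?addr0 //.
by move=> i /negPf->; rewrite mul0r mulr0.
Qed.

Lemma box_sub_ideal M (J : {pred R}) : is_ideal J ->
  (forall i, mpsX k i ^+ M \in J) -> {subset box_ideal M n <= J}.
Proof.
move=> idJ XJ t /(box_dec (leqnn n))[q _ ->].
by apply: (in_ideal_sum idJ) => i _; apply: (in_idealMr idJ).
Qed.

Lemma ideal_span_dotf r (g : 'rV[R]_r) t :
  reflect (exists q, t = dotf (g 0) q) (t \in ideal_span g).
Proof.
apply: (iffP (ideal_spanP _ _)) => [[a /matrixP/(_ 0 0)]|[q ->]].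
  by rewrite !mxE eqxx mulr1n => <-; exists (a^~ 0).
exists (\col_i q i); apply/matrixP => i j; rewrite !ord1 !mxE eqxx mulr1n.
by apply: eq_bigr => l _; rewrite mxE.
Qed.

Lemma null_idealP t : reflect (t 0%MM = 0) (t \in @null_ideal n k).
Proof.
apply: (iffP (ideal_span_dotf _ _)) => [[q ->]|t0].
  rewrite /dotf mps_sum big1 // => i _; rewrite mxE mpsM_eval0 /=.
  case: eqP => [/(congr1 (fun u : 'X_{1..n} => u i))|_]; last by rewrite mul0r.
  by rewrite mnm0E mnm1E eqxx.
have : t \in box_ideal 1 n.
  apply/box_idealP => m hm; suff -> : m = 0%MM by [].
  by apply/mnmP => i; rewrite mnm0E; apply/eqP; rewrite -leqn0 -ltnS hm.
case/(box_dec (leqnn n)) => q _ ->; exists q.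
by apply: eq_bigr => i _; rewrite mxE expr1.
Qed.

Lemma mpsX_null i : mpsX k i \in @null_ideal n k.
Proof.
apply/null_idealP => /=; case: eqP => //.
by move/(congr1 (fun m : 'X_{1..n} => m i)); rewrite mnm0E mnm1E eqxx.
Qed.

Lemma null_ideal_is_ideal : is_ideal (@null_ideal n k).
Proof. exact: ideal_span_is_ideal. Qed.

(** Exactness of the Koszul complex of the variables in degree one, by induction on the number s of
    entries allowed to be nonzero. The last entry lies in (x_0, ..., x_(s-1)) by regularity and is
    cleared by a boundary. *)
Lemma koszul_degree1 (p : 'I_n -> R) : dotf (mpsX k) p = 0 ->
  exists u : 'I_n -> 'I_n -> R, forall i,
    p i = \sum_j mpsX k j * u j i - dotf (mpsX k) (u i).
Proof.
suff gen s : (s <= n)%N -> forall p : 'I_n -> R,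
    (forall i : 'I_n, (s <= i)%N -> p i = 0) -> dotf (mpsX k) p = 0 ->
    exists u : 'I_n -> 'I_n -> R, forall i,
      p i = \sum_j mpsX k j * u j i - dotf (mpsX k) (u i).
  by apply: (gen n) => // i; rewrite leqNgt ltn_ord.
elim: s {p} => [|s IHs] ltsn p p0 xp.
  exists (fun _ _ => 0) => i; rewrite p0 // /dotf !big1 ?subr0 // => j _; exact: mulr0.
pose i0 := Ordinal ltsn; have [P0 PD PM] := box_ideal_is_ideal 1 s.
have : p i0 \in box_ideal 1 i0.
  apply: box_regular; rewrite expr1.
  move: xp; rewrite /dotf (bigD1 i0) //= => /eqP; rewrite addr_eq0 => /eqP->.
  apply: (in_idealN (box_ideal_is_ideal _ _)).
  apply: (in_ideal_sum (box_ideal_is_ideal _ _)) => i ne.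
  have [lt_is|le_si] := ltnP i s.
    by apply: (in_idealMr (box_ideal_is_ideal _ _)); rewrite -[mpsX k i]expr1 mpsX_box.
  rewrite p0 ?mulr0 // ltn_neqAle le_si andbT; apply: contraNneq ne => s_i.
  exact/eqP/val_inj.
case/(box_dec (ltnW ltsn)) => q q0 p_i0.
have {}p_i0 : p i0 = dotf (mpsX k) q.
  by rewrite p_i0; apply: eq_bigr => i _; rewrite expr1.
(* This adds the Koszul boundary of e_i0 /\ q to p, which cancels the entry at i0. *)
pose p' i := if i == i0 then 0 else p i + mpsX k i0 * q i.
have [||u hu] := IHs (ltnW ltsn) p'.
- move=> i le_si; rewrite /p'; case: (i =P i0) => // /eqP ne.
  rewrite q0 // mulr0 addr0 p0 // ltn_neqAle le_si andbT.
  by apply: contraNneq ne => s_i; apply/eqP/val_inj.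
- rewrite -xp /dotf [LHS](bigD1 i0) //= [RHS](bigD1 i0) //= /p' eqxx mulr0 add0r.
  rewrite p_i0 /dotf [in RHS](bigD1 i0) //= q0 // mulr0 add0r mulr_sumr.
  rewrite addrC -big_split /=.
  apply: eq_bigr => i /negPf->; rewrite mulrDr; congr (_ + _); ring.
exists (fun j i => u j i + (i == i0)%:R * q j) => i.
transitivity (p' i + (i == i0)%:R * p i0 - mpsX k i0 * q i).
  rewrite /p'; case: (i =P i0) => [->|_]; first by rewrite q0 // mulr0 subr0 add0r mul1r.
  by rewrite mul0r addr0 addrK.
have -> : dotf (mpsX k) (fun j => u i j + (j == i0)%:R * q i) =
    dotf (mpsX k) (u i) + mpsX k i0 * q i.
  rewrite /dotf; under eq_bigr do rewrite mulrDr; rewrite big_split /=; congr (_ + _).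
  rewrite (bigD1 i0) //= eqxx mul1r big1 ?addr0 // => j /negPf->.
  by rewrite mul0r mulr0.
under [in RHS]eq_bigr do rewrite mulrDr; rewrite big_split /= hu p_i0 /dotf mulr_sumr.
under [X in _ + X - _ = _]eq_bigr do rewrite mulrCA.
ring.
Qed.

End BoxIdeals.

(** * Perfect pairings on quotients of the power series ring *)

Section FrobeniusFunctionals.
Variables (n : nat) (k : fieldType).
Hypothesis char0 : [pchar k] =i pred0.
Local Notation R := (mpseries n k).
Implicit Types (m : 'X_{1..n}) (t : R) (psi phi : R -> k).

Definition mps_klinear psi := @klinear k R (@mpsC n k) R^o psi.

Lemma mps_klinearD psi : mps_klinear psi -> {morph psi : x y / x + y}.
Proof. exact: (klinearD (@mpsC1 n k)). Qed.

Lemma mps_klinearN psi : mps_klinear psi -> {morph psi : x / - x}.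
Proof. exact: (klinearN (@mpsCD n k) (@mpsC1 n k)). Qed.

Lemma mps_klinearC psi c t : mps_klinear psi -> psi (mpsC n c * t) = c * psi t.
Proof. exact: (klinearZ (@mpsC1 n k)). Qed.

Lemma mps_klinearM psi t : mps_klinear psi -> mps_klinear (fun h => psi (t * h)).
Proof.
move=> lin c x y; rewrite -[c in LHS]/c -[mpsC n c *: x]/(mpsC n c * x).
by rewrite mulrDr mulrCA mps_klinearD // mps_klinearC.
Qed.

(** The pairing of a and b to phi(a b) is perfect on R/I, stated on R. *)
Definition frobenius_functional (I : {pred R}) phi :=
  [/\ mps_klinear phi,
      forall t, t \in I -> phi t = 0,
      forall t, (forall h, phi (t * h) = 0) -> t \in I
    & forall psi, mps_klinear psi -> (forall t, t \in I -> psi t = 0) ->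
        exists g, forall h, psi h = phi (g * h)].

Definition box_top M : 'X_{1..n} := [multinom M.-1 | _ < n].

Lemma box_topP M m : (0 < M)%N ->
  reflect (forall i, (m i < M)%N) (m <= box_top M)%MM.
Proof.
case: M => // M _.
by apply: (iffP mnm_lepP) => h i; have := h i; rewrite mnmE.
Qed.

Lemma box_truncation M t : (0 < M)%N ->
  t - \sum_(v : 'X_{1..n < (mdeg (box_top M)).+1}) mpsC n (t v) * mpsXm k v
    \in box_ideal M n.
Proof.
move=> M_gt0; apply/box_idealP => m hm.
have le_m : (m <= box_top M)%MM by apply/box_topP => // i; apply: hm.
have lt_m : (mdeg m < (mdeg (box_top M)).+1)%N.
  by rewrite ltnS -(submK le_m) mdegD leq_addl.
rewrite mpsD mpsN mps_sum (bigD1 (BMultinom lt_m)) // mpsCM mpsXmE eqxx mulr1.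
rewrite big1; first by rewrite /= addr0 subrr.
move=> v ne; rewrite mpsCM mpsXmE.
case: eqP => [mv|_]; last by rewrite mulr0.
by case/eqP: ne; apply/val_inj.
Qed.

(** An arbitrary functional need not be determined by its values on monomials; agreement on the box
    ideal reduces the comparison to finitely many of them. *)
Lemma klinear_box_eq M phi psi : (0 < M)%N -> mps_klinear phi -> mps_klinear psi ->
    (forall t, t \in box_ideal M n -> phi t = psi t) ->
    (forall m, (m <= box_top M)%MM -> phi (mpsXm k m) = psi (mpsXm k m)) ->
  phi =1 psi.
Proof.
move=> M_gt0 linphi linpsi box mon t.
set s := \sum_(v : 'X_{1..n < (mdeg (box_top M)).+1}) mpsC n (t v) * mpsXm k v.
have sE : phi s = psi s.
  rewrite /s (klinear_sum (@mpsC1 n k) _ _ linphi) (klinear_sum (@mpsC1 n k) _ _ linpsi).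
  apply: eq_bigr => v _; rewrite !mps_klinearC //; congr (_ * _).
  have [le_v|nle] := boolP (v <= box_top M)%MM; first exact: mon.
  apply: box; apply/box_idealP => m hm; rewrite /=; case: eqP => // mv.
  by case/negP: nle; apply/box_topP => // i; rewrite -mv hm.
rewrite -(subrK s t) (mps_klinearD linphi) (mps_klinearD linpsi) sE.
by rewrite box // box_truncation.
Qed.

(** Modulo the box ideal, x^m and x^(top - m) are dual bases for the pairing, which dictates the
    coefficients of the representing series. *)
Lemma box_frobenius M : (0 < M)%N ->
  frobenius_functional (box_ideal M n) (fun t => t (box_top M)).
Proof.
move=> M_gt0.
have lin : mps_klinear (fun t => t (box_top M)).
  by move=> c x y; rewrite -[mpsC n c *: x]/(mpsC n c * x) mpsD mpsCM.
have top_lt (i : 'I_n) : (box_top M i < M)%N by rewrite mnmE prednK.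
split=> // [t /box_idealP->|t ht|psi linpsi psi0] //.
  apply/box_idealP => m hm.
  have le_m : (m <= box_top M)%MM by apply/box_topP => // i; apply: hm.
  have := ht (mpsXm k (box_top M - m)).
  by rewrite mulrC -{2}(submK le_m) mpsXmM.
exists (MPSeries (fun m => if (m <= box_top M)%MM then psi (mpsXm k (box_top M - m))
                           else 0)).
set g := MPSeries _.
apply: (klinear_box_eq M_gt0 linpsi (mps_klinearM g lin)) => [t tI|m le_m].
  rewrite psi0 //; have /box_idealP-> // := in_idealMl (box_ideal_is_ideal n k M n) g tI.
have topE : box_top M = (m + (box_top M - m))%MM by rewrite addmC submK.
rewrite mulrC [in RHS]topE mpsXmM /=.
have -> : (box_top M - m <= box_top M)%MM by rewrite [X in (_ <= X)%MM]topE lem_addl.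
by congr (psi (mpsXm k _)); rewrite {1}topE addmK.
Qed.

(** Here J = P : Delta. A functional vanishing on J is represented modulo P by some g. If g were
    outside (Delta) + P, a functional killing that ideal with value 1 at g would be represented by
    some g' in J, and pairing g with g' gives 1 = 0. *)
Lemma colon_frobenius (P J : {pred R}) phi Delta :
    is_ideal P -> is_ideal J -> frobenius_functional P phi ->
    (forall b, b * Delta \in P <-> b \in J) ->
  frobenius_functional J (fun h => phi (Delta * h)).
Proof.
move=> idP idJ [lin phi0 nondeg rep] colon; split.
- exact: mps_klinearM.
- by move=> t /colon; rewrite mulrC; apply: phi0.
- move=> t ht; apply/colon/nondeg => h; rewrite -(ht h); congr phi; ring.
move=> psi linpsi psi0.
have PJ t : t \in P -> t \in J by move=> Pt; apply/colon; rewrite (in_idealMr idP).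
have [g hg] := rep _ linpsi (fun t Pt => psi0 _ (PJ t Pt)).
pose U (z : R^o) := exists q : R, (z : R) - Delta * q \in P.
have [[q hq]|nU] := pselect (U g).
  exists q => h; rewrite hg mulrA -[g](subrK (Delta * q)) mulrDl.
  by rewrite (mps_klinearD lin) phi0 ?add0r // (in_idealMr idP).
have [|| psi' [linpsi' psi'U psi'g]] := @functional_separation _ _ _ (@mpsCD n k)
    (@mpsCMC n k) (@mpsC1 n k) R^o U g _ _ nU.
- move=> c x y [a ha] [b hb]; exists (mpsC n c * a + b).
  have := in_idealD idP (in_idealMl idP (mpsC n c) ha) hb.
  congr (_ \in P); rewrite -[mpsC n c *: x]/(mpsC n c * (x : R)); ring.
- by exists 0; rewrite mulr0 subr0; case: idP.
have UP t : t \in P -> U t by exists 0; rewrite mulr0 subr0.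
have [g' hg'] := rep _ linpsi' (fun t Pt => psi'U _ (UP t Pt)).
have /colon/psi0 : g' * Delta \in P.
  apply: nondeg => h; rewrite -mulrA -hg'; apply: psi'U.
  by exists h; rewrite subrr; case: idP.
by rewrite hg mulrC -hg' psi'g => /eqP; rewrite oner_eq0.
Qed.

(** If u represents psi modulo the box ideal P, nondegeneracy says I = P : u, and [colon_frobenius]
    applies. *)
Lemma nondegenerate_frobenius (I : {pred R}) psi M : (0 < M)%N -> is_ideal I ->
    {subset box_ideal M n <= I} -> mps_klinear psi ->
    (forall t, t \in I -> psi t = 0) ->
    (forall t, (forall h, psi (t * h) = 0) -> t \in I) ->
  exists phi, frobenius_functional I phi.
Proof.
move=> M_gt0 idI PI lin psi0 nondeg.
have frP := box_frobenius M_gt0; have [linP phi0 nondegP rep] := frP.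
have [u hu] := rep _ lin (fun t Pt => psi0 _ (PI t Pt)).
exists (fun h => (u * h) (box_top M)).
apply: (colon_frobenius (box_ideal_is_ideal n k M n) idI frP) => b; split=> [bu|Ib].
  apply: nondeg => h; rewrite hu mulrA [u * b]mulrC phi0 //.
  exact: in_idealMr (box_ideal_is_ideal n k M n) _ _ bu.
apply: nondegP => h; rewrite [b * u]mulrC -mulrA -hu; apply: psi0.
by rewrite (in_idealMr idI).
Qed.

(* A complete intersection is Gorenstein: x_i^M = sum_j g_j a_ji exhibits the
   span of g as the colon ideal (x_1^M, ..., x_n^M) : det a. *)
Lemma complete_intersection_frobenius (g : 'rV[R]_n) M : (0 < M)%N ->
    (forall i, mpsX k i ^+ M \in ideal_span g) ->
  exists phi, frobenius_functional (ideal_span g) phi.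
Proof.
move=> M_gt0 XJ; have idJ := ideal_span_is_ideal g.
have ha i : exists a, mpsX k i ^+ M = dotf (g 0) a by apply/ideal_span_dotf.
have [a {}ha] := fin_all_exists ha.
(* [wiebe] takes sequences indexed by nat; the values from n on are mere defaults. *)
pose p s := oapp (fun i : 'I_n => mpsX k i ^+ M) 0 (insub s).
pose a' s := oapp a (fun=> 0) (insub s).
have pE s (lt_sn : (s < n)%N) : p s = mpsX k (Ordinal lt_sn) ^+ M.
  by rewrite /p (insubT (fun s => s < n)%N lt_sn).
have [|||||||Delta [colon DP]] := @wiebe _ n (mps_torsion_free char0) (g 0) p a'
    (box_ideal M).
- by move=> s lt_sn; rewrite pE ha /a' (insubT (fun s => s < n)%N lt_sn).
- exact: box_ideal_is_ideal.
- exact: box_ideal0.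
- by move=> s _; apply: box_ideal_sub.
- by move=> s lt_sn; rewrite pE; apply: mpsX_box.
- by move=> s c lt_sn; rewrite pE; apply: (@box_regular _ _ M (Ordinal lt_sn)).
- by move=> s t lt_sn; rewrite pE; apply: (@box_decS _ _ M (Ordinal lt_sn)).
exists (fun h => (Delta * h) (box_top M)).
apply: (colon_frobenius (box_ideal_is_ideal n k M n) idJ (box_frobenius M_gt0)) => b.
split=> [/colon[q ->]|/ideal_span_dotf[q ->]]; first by apply/ideal_span_dotf; exists q.
rewrite mulr_suml; apply: (in_ideal_sum (box_ideal_is_ideal n k M n)) => j _.
by rewrite mulrAC (in_idealMr (box_ideal_is_ideal n k M n)).
Qed.

(* Kunz's theorem: an almost complete intersection (g, f) with Gorenstein
   quotient has a syzygy with a unit entry. *)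
Lemma gorenstein_unit_syzygy (g : 'rV[R]_n) (I : {pred R}) f phi psi :
    is_ideal I -> {subset I <= @null_ideal n k} ->
    (forall t, t \in I <-> exists q, t - f * q \in ideal_span g) ->
    frobenius_functional (ideal_span g) phi -> frobenius_functional I psi ->
  ~ (forall c t, dotf (g 0) c + f * t = 0 ->
       t \in @null_ideal n k /\ forall i, c i \in @null_ideal n k).
Proof.
move=> idI Inull IE [linphi phi0 nondegphi repphi] [linpsi psi0 nondegpsi reppsi] syz.
have idJ := ideal_span_is_ideal g.
have JI t : t \in ideal_span g -> t \in I.
  by move=> Jt; apply/IE; exists 0; rewrite mulr0 subr0.
have If : f \in I by apply/IE; exists 1; rewrite mulr1 subrr; case: idJ.
(* Linkage: with psi = phi(d -), duality gives J : d = I and J : f = J + (d). *)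
have [d hd] := repphi _ linpsi (fun t Jt => psi0 _ (JI t Jt)).
have dI t : t \in I -> d * t \in ideal_span g.
  move=> It; apply: nondegphi => h; rewrite -mulrA -hd psi0 //.
  by rewrite (in_idealMr idI).
have colon_d t : d * t \in ideal_span g -> t \in I.
  move=> Jdt; apply: nondegpsi => h; rewrite hd mulrA phi0 //.
  by rewrite (in_idealMr idJ).
have colon_f t : f * t \in ideal_span g -> exists q, t - d * q \in ideal_span g.
  move=> Jft; have [||q hq] := reppsi (fun h => phi (t * h)).
  - exact: mps_klinearM.
  - move=> s /IE[q hq]; rewrite -(subrK (f * q) s) mulrDr (mps_klinearD linphi).
    rewrite phi0 ?(in_idealMl idJ) // add0r phi0 // mulrCA mulrA.
    by rewrite (in_idealMr idJ).
  exists q; apply: nondegphi => h; rewrite mulrBl (mps_klinearD linphi).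
  by rewrite (mps_klinearN linphi) hq hd mulrA subrr.
have /ideal_span_dotf[c hc] := dI _ If.
have [dnull cnull] : d \in @null_ideal n k /\ forall i, - c i \in @null_ideal n k.
  apply: syz; rewrite [f * d]mulrC hc /dotf -big_split big1 // => i _ /=.
  by rewrite mulrN addNr.
have /ideal_span_dotf[y hy] := dnull.
have hz i : exists z, - c i = dotf (mpsX k) z.
  have /ideal_span_dotf[z ->] := cnull i; exists z.
  by apply: eq_bigr => j _; rewrite mxE.
have [z {}hz] := fin_all_exists hz.
have {}hy : d = dotf (mpsX k) y by rewrite hy; apply: eq_bigr => j _; rewrite mxE.
(* Expanding d and the c_j in the variables turns the syzygy d f = sum_j g_j c_j into a Koszul
   1-cycle p, congruent to f y modulo J. *)
pose p i := f * y i + \sum_j g 0 j * z j i.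
have [u hu] : exists u : 'I_n -> 'I_n -> R, forall i,
    p i = \sum_j mpsX k j * u j i - dotf (mpsX k) (u i).
  apply: koszul_degree1; transitivity (f * d + \sum_j g 0 j * - c j).
    rewrite hy {1 2}/dotf mulr_sumr.
    under [X in _ = _ + X]eq_bigr do rewrite hz /dotf mulr_sumr.
    rewrite exchange_big -big_split; apply: eq_bigr => i _ /=.
    rewrite /p mulrDr mulrCA mulr_sumr; congr (_ + _).
    by apply: eq_bigr => j _; rewrite mulrCA.
  rewrite [f * d]mulrC hc /dotf -big_split big1 // => i _ /=.
  by rewrite mulrN subrr.
have natnull q : (q.+1%:R : R) \notin @null_ideal n k.
  apply/negP => /null_idealP; rewrite mpsMn /= eqxx => /eqP.
  by rewrite (negPf (natf0 char0 q)).
have uE i : \sum_j mpsX k j * u j i - dotf (mpsX k) (u i) - f * y i \in ideal_span g.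
  rewrite -hu /p addrAC subrr add0r.
  apply: (in_ideal_sum idJ) => j _; apply: (in_idealMr idJ).
  by apply/ideal_span_dotf; exists (ord_delta R j); exact/esym/dotf_delta.
exact: (gulliksen_descent (mps_torsion_free char0) idJ idI (null_ideal_is_ideal n k)
  (@mpsX_null n k) Inull natnull hy (fun t => proj1 (IE t)) colon_d colon_f uE).
Qed.

End FrobeniusFunctionals.

(** * Logarithmic derivations *)

Section LogarithmicDerivations.
Variables (n : nat) (k : fieldType) (f : mpseries n k).
Hypothesis char0 : [pchar k] =i pred0.
Hypothesis isolated_f : isolated_singularity f.
Local Notation R := (mpseries n k).
Local Notation partial i := (mps_deriv i f).
Implicit Types (t : R) (v : 'I_n -> R).

Lemma jacobian_idealP t :
  reflect (exists q, t = \sum_i partial i * q i) (t \in jacobian_ideal f).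
Proof.
apply: (iffP (ideal_span_dotf _ _)) => -[q ->]; exists q;
  by apply: eq_bigr => i _; rewrite mxE.
Qed.

Lemma dotf_tjurina (v : 'I_(n + 1) -> R) :
  dotf (tjurina_gens f 0) v =
  \sum_i partial i * v (lshift 1 i) + f * v (rshift n ord0).
Proof.
rewrite /dotf big_split_ord big_ord1 /=; congr (_ + _).
  by apply: eq_bigr => i _; rewrite row_mxEl mxE.
by rewrite row_mxEr mxE eqxx.
Qed.

Lemma tjurina_idealP t :
  t \in tjurina_ideal f <-> exists q, t - f * q \in jacobian_ideal f.
Proof.
split=> [/ideal_span_dotf[v ->]|[q /jacobian_idealP[v tE]]].
  exists (v (rshift n ord0)); apply/jacobian_idealP.
  by exists (fun i => v (lshift 1 i)); rewrite dotf_tjurina addrK.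
apply/ideal_span_dotf.
exists (fun i => if split i is inl j then v j else q).
rewrite dotf_tjurina -(subrK (f * q) t) tE; congr (_ + _).
  by apply: eq_bigr => i _; rewrite (unsplitK (inl i)).
by rewrite (unsplitK (inr ord0)).
Qed.

Lemma tjurina_ideal_is_ideal : is_ideal (tjurina_ideal f).
Proof. exact: ideal_span_is_ideal. Qed.

Lemma partial_tjurina i : partial i \in tjurina_ideal f.
Proof.
apply/tjurina_idealP; exists 0; rewrite mulr0 subr0; apply/jacobian_idealP.
exists (ord_delta R i); rewrite -[LHS](dotf_delta (fun i => partial i)).
by [].
Qed.

Lemma f_tjurina : f \in tjurina_ideal f.
Proof.
apply/tjurina_idealP; exists 1; rewrite mulr1 subrr.
exact: in_ideal0 (ideal_span_is_ideal _).
Qed.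

Lemma tjurina_sub_null : {subset tjurina_ideal f <= @null_ideal n k}.
Proof.
have [_ _ _ [_ rad]] := isolated_f.
by move=> t It; apply/rad; exists 1%N; rewrite expr1.
Qed.

(* A syzygy with a unit among its first entries would give a derivation
   [sum_j v_j d/dx_j] preserving the Tjurina ideal and, in characteristic zero,
   lowering the power of [x_i] lying in that ideal, down to [1]. *)
Lemma syzygy_null v t i :
  \sum_j partial j * v j + f * t = 0 -> v i \in @null_ideal n k.
Proof.
move=> rel; have [_ _ _ [[_ nI1 prim] rad]] := isolated_f.
set I := tjurina_ideal f in nI1 prim rad.
have idI : is_ideal I := tjurina_ideal_is_ideal.
pose D h := \sum_j v j * mps_deriv j h.
have DM a b : D (a * b) = D a * b + a * D b.
  rewrite /D mulr_suml mulr_sumr -big_split; apply: eq_bigr => j _ /=.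
  by rewrite mps_derivM mulrDr mulrA [v j * (a * _)]mulrCA.
have DD : {morph D : a b / a + b}.
  move=> a b; rewrite /D -big_split; apply: eq_bigr => j _ /=.
  by rewrite mps_derivD mulrDr.
have Df : D f \in I.
  have -> : D f = - (f * t).
    apply/eqP; rewrite -addr_eq0 -[X in _ == X]rel; apply/eqP; congr (_ + _).
    by apply: eq_bigr => j _; rewrite mulrC.
  by rewrite (in_idealN idI) // (in_idealMr idI) // f_tjurina.
have deriv0 j : mps_deriv j (0 : R) = 0.
  by apply/mpsP => m; rewrite /= mul0rn.
(* Apply d/dx_j to the syzygy and commute the partial derivatives. *)
have Dpartial j : D (partial j) \in I.
  have -> : D (partial j) = - (\sum_l partial l * mps_deriv j (v l) +
      (partial j * t + f * mps_deriv j t)).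
    have := congr1 (mps_deriv j) rel; rewrite mps_derivD mps_derivM deriv0 => rel'.
    apply/eqP; rewrite -addr_eq0 addrA -[X in _ == X]rel'; apply/eqP.
    congr (_ + _); rewrite (big_morph _ (mps_derivD j) (deriv0 j)) -big_split.
    apply: eq_bigr => l _ /=; rewrite mps_derivM mps_deriv_comm; congr (_ + _).
    exact: mulrC.
  apply: (in_idealN idI); apply: (in_idealD idI).
    apply: (in_ideal_sum idI) => l _; apply: (in_idealMr idI).
    exact: partial_tjurina.
  by apply: (in_idealD idI); apply: (in_idealMr idI); rewrite ?partial_tjurina ?f_tjurina.
have DI h : h \in I -> D h \in I.
  move=> /tjurina_idealP[q /jacobian_idealP[a hE]].
  rewrite -(subrK (f * q) h) hE DD; apply: (in_idealD idI).
    have D0 : D 0 = 0 by rewrite /D big1 // => j _; rewrite deriv0 mulr0.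
    rewrite (big_morph _ DD D0); apply: (in_ideal_sum idI) => j _.
    rewrite DM; apply: (in_idealD idI); apply: (in_idealMr idI) => //.
    exact: partial_tjurina.
  rewrite DM; apply: (in_idealD idI); apply: (in_idealMr idI) => //.
  exact: f_tjurina.
have DX e : D (mpsX k i ^+ e.+1) = (mpsX k i ^+ e * v i) *+ e.+1.
  have D1 : D (mpsX k i) = v i.
    rewrite /D (bigD1 i) //= mps_derivX eqxx mulr1 big1 ?addr0 // => j /negPf ne.
    by rewrite mps_derivX ne mulr0.
  elim: e => [|e IHe]; first by rewrite expr0 expr1 mul1r.
  rewrite exprS DM IHe D1 [in RHS]mulrS -mulrnAr mulrA -exprS mulrnAr.
  by rewrite [v i * _]mulrC.
have [//|nvi] := boolP (v i \in @null_ideal n k).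
(* D sends x_i^(e+1) to (e+1) x_i^e v_i; primariness removes v_i, which is outside the radical. *)
have step e : mpsX k i ^+ e.+1 \in I -> mpsX k i ^+ e \in I.
  move=> /DI; rewrite DX => /(in_idealMl idI (mpsC n e.+1%:R^-1)).
  rewrite -[_ * v i *+ _]mulr_natl [mpsC _ _ * _]mulrA.
  have -> : mpsC n e.+1%:R^-1 * e.+1%:R = 1 :> R.
    apply/mpsP => m; rewrite mpsCM mpsMn mulrnAr -mulrnAl.
    by rewrite -[_^-1 *+ _]mulr_natr mulVf ?natf0 // mul1r.
  rewrite mul1r => /prim[//|/rad vi]; by rewrite vi in nvi.
have [e Xe] : exists e, mpsX k i ^+ e \in I.
  by apply/rad; apply: mpsX_null.
by elim: e Xe => [|e IHe /step//]; rewrite expr0 => I1; rewrite I1 in nI1.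
Qed.

(** f t lies in the Jacobian ideal, which is primary, and t lies outside its radical. *)
Lemma unit_syzygy_quasihomogeneous v t :
    \sum_j partial j * v j + f * t = 0 -> t \notin @null_ideal n k ->
  quasihomogeneous f.
Proof.
move=> rel; have [_ _ [[_ _ prim] rad] _] := isolated_f.
have : f * t \in jacobian_ideal f.
  apply/jacobian_idealP; exists (fun i => - v i).
  move/eqP: rel; rewrite addrC addr_eq0 => /eqP->; rewrite -sumrN.
  by apply: eq_bigr => j _; rewrite mulrN.
by case/prim => // /rad ->.
Qed.

End LogarithmicDerivations.

(** * Syzygies and generators modulo the maximal ideal *)

Section SyzygyRank.
Variables (n : nat) (k : fieldType).
Local Notation R := (mpseries n k).

Fact mps_eval0_zmod : zmod_morphism (@mps_eval0 n k).
Proof. by []. Qed.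
Fact mps_eval0_monoid : monoid_morphism (@mps_eval0 n k).
Proof. by split=> [|x y]; [rewrite /mps_eval0 /= eqxx | apply: mpsM_eval0]. Qed.
HB.instance Definition _ :=
  GRing.isZmodMorphism.Build R k (@mps_eval0 n k) mps_eval0_zmod.
HB.instance Definition _ :=
  GRing.isMonoidMorphism.Build R k (@mps_eval0 n k) mps_eval0_monoid.

Variable f : R.
Hypothesis char0 : [pchar k] =i pred0.
Hypothesis isolated_f : isolated_singularity f.
Local Notation gens := (tjurina_gens f).
Local Notation ev := (map_mx (@mps_eval0 n k)).

Lemma syzygy_matrix_usub m (S : 'M[R]_(n + 1, m)) :
  gens *m S = 0 -> usubmx (ev S) = 0.
Proof.
move=> gS0; apply/matrixP => i j; rewrite !mxE; apply/null_idealP.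
have /matrixP/(_ 0 j) := gS0; rewrite !mxE -/(dotf _ (S^~ j)).
rewrite (dotf_tjurina f (S^~ j)).
exact: (syzygy_null char0 isolated_f (v := fun i => S (lshift 1 i) j)).
Qed.

Lemma syzygy_matrix0 m (S : 'M[R]_(n + 1, m)) :
  gens *m S = 0 -> ~ quasihomogeneous f -> ev S = 0.
Proof.
move=> gS0 nq; rewrite -[LHS]vsubmxK (syzygy_matrix_usub gS0).
suff -> : dsubmx (ev S) = 0 by rewrite col_mx0.
apply/matrixP => i j; rewrite ord1 !mxE; apply/null_idealP.
have /matrixP/(_ 0 j) := gS0; rewrite !mxE -/(dotf _ (S^~ j)).
rewrite (dotf_tjurina f (S^~ j)) => rel; apply: contra_notT nq.
exact: (unit_syzygy_quasihomogeneous isolated_f rel).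
Qed.

Lemma generators_change s (h : 'rV[R]_s) : ideal_span h =i tjurina_ideal f ->
  exists (B : 'M[R]_(n + 1, s)) (A : 'M[R]_(s, n + 1)), gens *m (B *m A - 1%:M) = 0.
Proof.
have lift r r' (g : 'rV[R]_r) (g' : 'rV[R]_r') :
    (forall j, g' 0 j \in ideal_span g) -> exists A : 'M[R]_(r, r'), g' = g *m A.
  move=> gg'; have hq j : exists q, g' 0 j = dotf (g 0) q by apply/ideal_span_dotf.
  have [q {}hq] := fin_all_exists hq; exists (\matrix_(i, j) q j i).
  apply/matrixP => i j; rewrite ord1 hq !mxE; apply: eq_bigr => l _.
  by rewrite mxE.
have mem r (g : 'rV[R]_r) j : g 0 j \in ideal_span g.
  by apply/ideal_span_dotf; exists (ord_delta R j); apply/esym/dotf_delta.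
move=> hI.
have [|A hA] := lift _ _ h gens; first by move=> j; rewrite hI; apply: mem.
have [|B hB] := lift _ _ gens h.
  by move=> j; rewrite -[ideal_span _]/(tjurina_ideal f) -hI; apply: mem.
by exists B, A; rewrite mulmxBr mulmxA -hB -hA mulmx1 subrr.
Qed.

(** Express two generating systems through each other by B and A: the columns of B A - 1 are
    syzygies. At the origin B A thus agrees with the identity in its first n rows, and in all n + 1
    rows unless f is quasihomogeneous, while its rank is at most s. *)
Lemma num_generators_ge s (h : 'rV[R]_s) : ideal_span h =i tjurina_ideal f ->
  (n <= s)%N /\ (~ quasihomogeneous f -> (n < s)%N).
Proof.
move=> /generators_change[B [A rel]].
have evE : ev (B *m A - 1%:M) = ev B *m ev A - 1%:M.
  by rewrite map_mxB map_mxM map_mx1.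
have rk : (\rank (ev B *m ev A) <= s)%N.
  exact: leq_trans (mxrankM_maxl _ _) (rank_leq_col _).
split.
  have := syzygy_matrix_usub rel; rewrite evE linearB /= => /eqP.
  rewrite subr_eq0 => /eqP BA1; apply: leq_trans rk.
  have rk1 : \rank (usubmx (1%:M : 'M[k]_(n + 1))) = n.
    apply/eqP; rewrite eqn_leq rank_leq_row /= scalar_mx_block /block_mx col_mxKu.
    have one : row_mx 1%:M (0 : 'M[k]_(n, 1)) *m col_mx 1%:M (0 : 'M[k]_(1, n)) = 1%:M.
      by rewrite mul_row_col mulmx0 addr0 mulmx1.
    rewrite -[X in (X <= _)%N](mxrank1 k n).
    have := mxrankM_maxl (row_mx 1%:M (0 : 'M[k]_(n, 1)))
                         (col_mx 1%:M (0 : 'M[k]_(1, n))).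
    by rewrite one.
  rewrite -[X in (X <= _)%N]rk1 -BA1; apply: mxrankS.
  by have := addsmxSl (usubmx (ev B *m ev A)) (dsubmx (ev B *m ev A)); rewrite addsmxE vsubmxK.
move=> nq; have := syzygy_matrix0 rel nq; rewrite evE => /eqP.
rewrite subr_eq0 => /eqP BA1; rewrite BA1 mxrank1 in rk.
by rewrite -addn1.
Qed.

(** If f = sum_i f_i q_i, the syzygy (q, -1) is a combination of columns of Z and survives at the
    origin. Conversely the columns of Z are syzygies. *)
Lemma presentation_rank m (Z : 'M[R]_(n + 1, m)) : presentation_matrix gens Z ->
  quasihomogeneous f <-> (0 < \rank (ev Z))%N.
Proof.
move=> presZ; rewrite lt0n mxrank_eq0; split=> [/jacobian_idealP[q fE]|nz].
  pose v : 'cV[R]_(n + 1) := \col_i (if split i is inl j then q j else -1).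
  have /presZ[w vE] : gens *m v = 0.
    apply/matrixP => i j; rewrite !ord1 [RHS]mxE !mxE -/(dotf _ (v^~ 0)).
    rewrite (dotf_tjurina f (v^~ 0)) !mxE (unsplitK (inr ord0)).
    rewrite mulrN1; apply/eqP; rewrite subr_eq0 [X in _ == X]fE; apply/eqP.
    by apply: eq_bigr => l _; rewrite !mxE (unsplitK (inl l)).
  apply/eqP => Z0; have /matrixP/(_ (rshift n ord0) 0) := congr1 ev vE.
  rewrite map_mxM Z0 mul0mx !mxE (unsplitK (inr ord0)) rmorphN1 => /eqP.
  by rewrite oppr_eq0 oner_eq0.
have [//|nq] := pselect (quasihomogeneous f).
case/eqP: nz; apply: syzygy_matrix0 nq.
apply/matrixP => i j; rewrite ord1 [RHS]mxE.
have /presZ/matrixP/(_ 0 0) : exists w, col j Z = Z *m w.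
  by exists (delta_mx j 0); rewrite colE.
by rewrite colE mulmxA -colE !mxE.
Qed.

End SyzygyRank.

(** * Artinian quotients *)

Section ChainConditions.
Variables (k : fieldType) (L : nat).

(** Take B of maximal rank with row space in U; adjoining a vector of U cannot raise the rank. *)
Lemma subspace_mx (U : 'rV[k]_L -> Prop) : U 0 ->
    (forall c v w, U v -> U w -> U (c *: v + w)) ->
  exists B : 'M[k]_L, forall v, U v <-> (v <= B)%MS.
Proof.
move=> U0 UP.
pose good (B : 'M[k]_L) := forall v : 'rV_L, (v <= B)%MS -> U v.
pose P r := `[< exists2 B, good B & \rank B = r >].
have exP : exists r, P r.
  exists 0%N; apply/asboolP; exists 0; last exact: mxrank0.
  by move=> v; rewrite submx0 => /eqP->.
have ubP r : P r -> (r <= L)%N by case/asboolP=> B _ <-; apply: rank_leq_row.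
case: (ex_maxnP exP ubP) => _ /asboolP[B gB <-] maxB.
exists B => v; split=> [Uv|]; last exact: gB.
have gBv : good (B + v)%MS.
  move=> w /sub_addsmxP[[a b]] /= ->.
  rewrite [b]mx11_scalar mul_scalar_mx addrC; apply: UP => //.
  by apply: gB; apply: submxMl.
have le_rk : (\rank (B + v)%MS <= \rank B)%N.
  by apply: maxB; apply/asboolP; exists (B + v)%MS.
have /mxrank_leqif_sup[le_rk' eq_rk] := addsmxSl B v.
have := eqn_leq (\rank B) (\rank (B + v)%MS); rewrite le_rk' le_rk eq_rk.
exact: submx_trans (addsmxSr B v).
Qed.

Variables (A : comPzRingType) (ev : 'rV[k]_L -> A) (iota : k -> A).
Hypothesis evP : forall c v w, ev (c *: v + w) = iota c * ev v + ev w.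
Hypothesis ev0 : ev 0 = 0.
Hypothesis ev_surj : forall a, exists v, a = ev v.

(** Ideals pull back to subspaces of k^L, and ranks detect strict inclusions, so both chain
    conditions reduce to bounded ranks. *)
Lemma ideal_chain_mx (I : nat -> {pred A}) : (forall j, is_ideal (I j)) ->
  exists B : nat -> 'M[k]_L, forall i j,
    ({subset I i <= I j} -> (\rank (B i) <= \rank (B j))%N) /\
    ({subset I i <= I j} -> (\rank (B j) <= \rank (B i))%N -> {subset I j <= I i}).
Proof.
move=> idI.
have ex j : exists B : 'M[k]_L, forall v, ev v \in I j <-> (v <= B)%MS.
  have [I0 ID IM] := idI j; apply: subspace_mx; first by rewrite ev0.
  by move=> c v w Iv Iw; rewrite evP; apply: ID => //; apply: IM.
have [B hB] := choice ex.
have sub i j : {subset I i <= I j} -> (B i <= B j)%MS.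
  move=> Iij; apply/row_subP => l; apply/hB/Iij/hB; exact: row_sub.
exists B => i j; split=> [/sub/mxrankS //|Iij le_rk a].
have [v ->] := ev_surj a; move=> /hB vj; apply/hB; apply: submx_trans vj _.
have /mxrank_leqif_sup[le_rk' <-] := sub _ _ Iij.
by rewrite eqn_leq le_rk' le_rk.
Qed.

Lemma finite_dim_noetherian : noetherian_ring A.
Proof.
move=> I idI incI; have [B hB] := ideal_chain_mx idI.
have mono i j : (i <= j)%N -> {subset I i <= I j}.
  move/subnK<-; elim: (j - i)%N => [|l IHl] a //= Ia.
  by rewrite addSn; apply/incI/IHl.
pose P r := `[< exists j, \rank (B j) = r >].
have exP : exists r, P r by exists (\rank (B 0%N)); apply/asboolP; exists 0%N.
have ubP r : P r -> (r <= L)%N by case/asboolP=> j <-; apply: rank_leq_row.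
case: (ex_maxnP exP ubP) => _ /asboolP[N <-] maxN.
exists N => j le_Nj a; apply/idP/idP; last exact: mono.
apply: (proj2 (hB N j)); first exact: mono.
by apply: maxN; apply/asboolP; exists j.
Qed.

Lemma finite_dim_artinian : artinian_ring A.
Proof.
move=> I idI decI; have [B hB] := ideal_chain_mx idI.
have mono i j : (i <= j)%N -> {subset I j <= I i}.
  move/subnK<-; elim: (j - i)%N => [|l IHl] a //=.
  by rewrite addSn => /decI/IHl.
pose P r := `[< exists j, \rank (B j) = r >].
have exP : exists r, P r by exists (\rank (B 0%N)); apply/asboolP; exists 0%N.
case: (ex_minnP exP) => _ /asboolP[N <-] minN.
exists N => j le_Nj a; apply/idP/idP; first exact: mono.
apply: (proj2 (hB j N)); first exact: mono.
by apply: minN; apply/asboolP; exists j.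
Qed.

End ChainConditions.

Lemma self_injective_inj_dim (A : comPzRingType) :
  injective_module (A^o : lmodType A) -> inj_dim_le (A^o : lmodType A) 0.
Proof.
move=> injA.
pose Z : lmodType A := 'rV[A]_0.
pose E i : lmodType A := if i is 0%N then A^o else Z.
have Z0 (x y : Z) : x = y by apply/matrixP => ? [].
pose delta i : {linear E i -> E i.+1} := \0.
exists E, idfun, delta; split=> //.
- case=> // i M N j g _; exists \0 => x; exact: Z0.
- by move=> y; split=> // _; exists y.
- by move=> i y; split=> [_|_]; [exists 0 | ]; apply: Z0.
- by case=> // i _ y; apply: Z0.
Qed.

(** * Finite-dimensional local quotients of the power series ring *)

Section FiniteQuotient.
Variables (n : nat) (k : fieldType) (s : nat) (g : 'rV[mpseries n k]_s) (M : nat).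
Local Notation R := (mpseries n k).
Local Notation I := (ideal_span g).
Local Notation A := (quot_span g).
Local Notation pi := (quot_span_pi g).
Hypothesis M_gt0 : (0 < M)%N.
Hypothesis boxI : {subset box_ideal M n <= I}.
Hypothesis nilI : forall t : R, t \in @null_ideal n k -> exists e, t ^+ e \in I.
Hypothesis Inull : {subset I <= @null_ideal n k}.
Implicit Types (t : R) (a : A).

Let idI : is_ideal I := ideal_span_is_ideal g.
Let pi1 : pi 1 = 1. Proof. by []. Qed.

Lemma pi0 : pi 0 = 0.
Proof. by apply: (@addrI _ (pi 0)); rewrite -quot_span_piD !addr0. Qed.

Lemma pi_surj a : exists t, a = pi t.
Proof. by exists (quot_span_repr a); rewrite quot_span_reprK. Qed.

Lemma pi_eq0 t : pi t = 0 <-> t \in I.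
Proof. by have := quot_span_piE g t 0; rewrite subr0 pi0. Qed.

Lemma pi_mul x y : pi (x * y) = pi x * pi y.
Proof. exact: quot_span_piM. Qed.

Lemma repr_pi t : t - quot_span_repr (pi t) \in I.
Proof. by apply/quot_span_piE; rewrite quot_span_reprK. Qed.

Definition quot_iota (c : k) : A := pi (mpsC n c).
Lemma quot_iotaD : {morph quot_iota : a b / a + b}.
Proof. by move=> a b; rewrite /quot_iota mpsCD quot_span_piD. Qed.
Lemma quot_iotaM : {morph quot_iota : a b / a * b}.
Proof. by move=> a b; rewrite /quot_iota mpsCMC pi_mul. Qed.
Lemma quot_iota1 : quot_iota 1 = 1.
Proof. by rewrite /quot_iota mpsC1. Qed.

Lemma preim_ideal (K : {pred A}) : is_ideal K -> is_ideal [pred t | pi t \in K].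
Proof.
case=> K0 KD KM; split=> [|x y|a x]; rewrite !inE ?pi0 //.
  by rewrite quot_span_piD; apply: KD.
by rewrite pi_mul; apply: KM.
Qed.

(** Multiply b by a monomial of largest degree keeping it outside K; the degree is bounded because
    monomials outside the box lie in K. *)
Lemma socle_multiple (K : {pred R}) b : is_ideal K -> {subset box_ideal M n <= K} ->
  b \notin K ->
  exists c, c * b \notin K /\ forall t, t \in @null_ideal n k -> t * (c * b) \in K.
Proof.
move=> idK boxK nKb.
pose P d := `[< exists2 m, mdeg m = d & mpsXm k m * b \notin K >].
have exP : exists d, P d.
  by exists 0%N; apply/asboolP; exists 0%MM; rewrite ?mdeg0 // mpsXm0 mul1r.
have ubP d : P d -> (d <= mdeg (box_top n M))%N.
  case/asboolP=> m <- nK; have [le|nle] := boolP (m <= box_top n M)%MM.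
    by rewrite -(submK le) mdegD leq_addl.
  case/negP: nK; apply: (in_idealMr idK); apply/boxK/box_idealP => u hu.
  rewrite mpsXmE; case: eqP => // um; case/negP: nle.
  by apply/box_topP => // i; rewrite -um hu.
case: (ex_maxnP exP ubP) => _ /asboolP[m <- nK] maxm.
exists (mpsXm k m); split=> // _ /ideal_span_dotf[q ->].
rewrite mulr_suml; apply: (in_ideal_sum idK) => i _; rewrite mxE mpsX_mpsXm.
rewrite mulrAC; apply: (in_idealMr idK); rewrite mulrA -mpsXmD.
apply: contraT => nKi.
have := maxm (mdeg (U_(i) + m)); rewrite mdegD mdeg1 add1n ltnn; apply.
by apply/asboolP; exists (U_(i) + m)%MM => //; rewrite mdegD mdeg1 add1n.
Qed.

Definition quot_null : {pred A} := fun a => quot_span_repr a \in @null_ideal n k.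

Lemma quot_nullE t : (pi t \in quot_null) = (t \in @null_ideal n k).
Proof.
have idm := null_ideal_is_ideal n k; have mI := Inull (repr_pi t).
rewrite /quot_null unfold_in; apply/idP/idP => h.
  by rewrite -(subrK (quot_span_repr (pi t)) t) (in_idealD idm).
by have := in_idealB idm h mI; rewrite subKr.
Qed.

Lemma quot_null_is_ideal : is_ideal quot_null.
Proof.
have idm := null_ideal_is_ideal n k; split=> [|a b|a b].
- by rewrite -pi0 quot_nullE (in_ideal0 idm).
- have [[x ->] [y ->]] := (pi_surj a, pi_surj b).
  by rewrite -quot_span_piD !quot_nullE; apply: in_idealD.
- have [[x ->] [y ->]] := (pi_surj a, pi_surj b).
  by rewrite -pi_mul !quot_nullE; apply: in_idealMl.
Qed.

(** Scaled to constant term 1, a representative is 1 - w with w nilpotent modulo I; invert by the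
    geometric series. *)
Lemma quot_unit a : a \notin quot_null -> exists b, b * a = 1.
Proof.
have [t ->] := pi_surj a; rewrite quot_nullE => /null_idealP/eqP t0.
pose c := mpsC n (t 0%MM)^-1; pose w := 1 - c * t.
have wnull : w 0%MM = 0.
  by rewrite /w mpsD mpsN mpsCM mulVf // /= eqxx subrr.
have [e we] : exists e, w ^+ e \in I by apply/nilI/null_idealP.
exists (pi (\sum_(i < e) w ^+ i * c)).
rewrite -mulr_suml -pi_mul -mulrA; apply/quot_span_piE.
have -> : c * t = 1 - w by rewrite /w subKr.
have geom (x : R) : (\sum_(i < e) x ^+ i) * (1 - x) = 1 - x ^+ e.
  by rewrite -[RHS]opprB subrX1 mulrC -[RHS]mulNr [in RHS]opprB.
by rewrite geom addrAC subrr add0r (in_idealN idI).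
Qed.

Lemma quot_socle_ex (K : {pred A}) : is_ideal K -> 1 \notin K ->
  exists t : A, t \notin K /\ forall a, a \in quot_null -> a * t \in K.
Proof.
move=> idK nK1; have idK' := preim_ideal idK; have [K0 _ _] := idK.
have [||c [nKc Kc]] := @socle_multiple _ 1 idK'.
- by move=> t /boxI /pi_eq0 t0; rewrite inE t0.
- by rewrite inE.
rewrite mulr1 in nKc Kc; exists (pi c); split=> // a.
have [t ->] := pi_surj a; rewrite quot_nullE => /Kc.
by rewrite inE pi_mul.
Qed.

Lemma quot_local : 1 \notin I -> local_ring A.
Proof.
move=> nI1; have idm := quot_null_is_ideal.
have max_null J : is_ideal J -> 1 \notin J -> {subset J <= quot_null}.
  move=> [_ _ JM] nJ1 a Ja; apply: contraR nJ1 => /quot_unit[b <-]; exact: JM.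
have n1 : 1 \notin quot_null.
  rewrite -pi1 quot_nullE; apply/null_idealP => /= /eqP.
  by rewrite eqxx oner_eq0.
exists quot_null; split=> [|J [idJ nJ1 maxJ] a].
  by split=> // J idJ nJ1 _; apply: max_null.
apply/idP/idP; first exact: max_null.
by apply: maxJ => //; apply: max_null.
Qed.

Let D := (mdeg (box_top n M)).+1.

(** The monomials of degree at most that of [box_top] span A, since the rest of any series falls
    into the box ideal. *)
Definition quot_ev (v : 'rV[k]_#|{: 'X_{1..n < D}}|) : A :=
  pi (\sum_(j < #|{: 'X_{1..n < D}}|) mpsC n (v 0 j) * mpsXm k (enum_val j)).

Lemma quot_evP c v w : quot_ev (c *: v + w) = quot_iota c * quot_ev v + quot_ev w.
Proof.
rewrite /quot_ev /quot_iota -pi_mul -quot_span_piD; congr pi.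
rewrite mulr_sumr -big_split; apply: eq_bigr => j _ /=.
by rewrite !mxE mpsCD mpsCMC mulrDl mulrA.
Qed.

Lemma quot_ev0 : quot_ev 0 = 0.
Proof.
rewrite /quot_ev big1 ?pi0 // => j _; rewrite mxE.
by apply/mpsP => m; rewrite mpsCM mul0r.
Qed.

Lemma quot_ev_surj a : exists v, a = quot_ev v.
Proof.
have [t ->] := pi_surj a; exists (\row_(j < #|{: 'X_{1..n < D}}|) t (enum_val j)).
apply/quot_span_piE/boxI; have := box_truncation t M_gt0.
rewrite (eq_bigl (mem {: 'X_{1..n < D}})) // big_enum_val /=.
suff -> : \sum_(j < #|{: 'X_{1..n < D}}|)
    mpsC n ((\row_(j < #|{: 'X_{1..n < D}}|) t (enum_val j)) 0 j) * mpsXm k (enum_val j) =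
  \sum_(j < #|{: 'X_{1..n < D}}|) mpsC n (t (enum_val j)) * mpsXm k (enum_val j) by [].
by apply: eq_bigr => j _; rewrite mxE.
Qed.

Lemma quot_noetherian : noetherian_ring A.
Proof. exact: finite_dim_noetherian quot_evP quot_ev0 quot_ev_surj. Qed.

Lemma quot_artinian : artinian_ring A.
Proof. exact: finite_dim_artinian quot_evP quot_ev0 quot_ev_surj. Qed.

Lemma frobenius_quot_gorenstein phi : 1 \notin I ->
  frobenius_functional I phi -> gorenstein_local_ring A.
Proof.
move=> nI1 [lin phi0 nondeg rep]; split.
- exact: quot_noetherian.
- exact: quot_local.
exists 0%N; apply: self_injective_inj_dim.
pose phiA (a : A^o) := phi (quot_span_repr a).
have phiE t : phiA (pi t) = phi t.
  apply/eqP; rewrite eq_sym -subr_eq0 -(mps_klinearN lin) -(mps_klinearD lin).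
  by rewrite phi0 ?repr_pi.
apply: (@frobenius_injective k A quot_iota quot_iotaD quot_iotaM quot_iota1 phiA).
- move=> c a b; have [[x ->] [y ->]] := (pi_surj a, pi_surj b).
  rewrite -[quot_iota c *: _]/(quot_iota c * pi x) -pi_mul -quot_span_piD !phiE.
  exact: lin.
- move=> a; have [x ->] := pi_surj a => ha; apply/pi_eq0/nondeg => h.
  by rewrite -phiE pi_mul.
move=> psi linpsi.
have [||g' hg] := rep (fun t => psi (pi t)).
- move=> c x y; rewrite -linpsi; congr psi.
  by rewrite quot_span_piD -[mpsC n c *: x]/(mpsC n c * x) pi_mul.
- move=> t /pi_eq0->; exact: (klinear0 quot_iota1 linpsi).
exists (pi g') => b; have [y ->] := pi_surj b.
by rewrite -pi_mul phiE hg.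
Qed.

(** The socle is generated by the class of one t; take psi vanishing on I with psi(t) = 1. Any b
    outside I has a multiple congruent to y t outside I, and psi(y t) = y(0) is then nonzero, so psi
    is nondegenerate. *)
Lemma gorenstein_quot_frobenius : 1 \notin I ->
  gorenstein_local_ring A -> exists phi, frobenius_functional I phi.
Proof.
move=> nI1 [_ _ [d injd]].
have nz1 : (1 : A) != 0 by apply: contra_notN (negP nI1) => /eqP/pi_eq0.
have [s0 [ns ms socs]] := finite_injdim_socle quot_unit
  quot_socle_ex quot_noetherian nz1 injd.
have [t sE] := pi_surj s0.
have nIt : t \notin I.
  by apply: contraNN ns => /pi_eq0 t0; rewrite sE t0.
have mt x : x \in @null_ideal n k -> x * t \in I.
  by move=> mx; apply/pi_eq0; rewrite pi_mul -sE ms // quot_nullE.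
have [|| psi [lin psi0 psit]] := @functional_separation _ _ _ (@mpsCD n k)
    (@mpsCMC n k) (@mpsC1 n k) R^o (fun x : R^o => x \in I) t _ _ (negP nIt).
- move=> c x y Ix Iy; apply: (in_idealD idI) => //.
  exact: (in_idealMl idI (mpsC n c) Ix).
- exact: in_ideal0.
apply: (nondegenerate_frobenius (psi := psi) M_gt0 idI boxI lin psi0) => b hb.
apply: contraT => nIb.
have [c [nIc mc]] := socle_multiple idI boxI nIb.
have [a aE] : exists a, pi (c * b) = a * s0.
  apply: socs => a; have [x ->] := pi_surj a; rewrite quot_nullE => /mc.
  by rewrite -pi_mul => /pi_eq0.
have [y yE] := pi_surj a.
have cb : c * b - y * t \in I.
  by apply/quot_span_piE; rewrite aE yE sE pi_mul.
have y0 : psi (y * t) = y 0%MM.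
  rewrite -(subrK (mpsC n (y 0%MM)) y) mulrDl (mps_klinearD lin).
  rewrite (mps_klinearC _ _ lin) psit mulr1 psi0 ?add0r //; last first.
    apply: mt; apply/null_idealP; rewrite mpsD mpsN /= eqxx mulr1n.
    by rewrite subrr.
  by rewrite mpsD mpsD mpsN /= eqxx mulr1n subrK.
have yn : y 0%MM = 0.
  rewrite -y0 -[y * t](subKr (c * b)) (mps_klinearD lin) (mps_klinearN lin).
  by rewrite (psi0 _ cb) subr0 mulrC hb.
case/negP: nIc; rewrite -(subrK (y * t) (c * b)) (in_idealD idI) //.
by apply: mt; apply/null_idealP.
Qed.

End FiniteQuotient.

(** * Combining the implications for the Tjurina algebra *)

Lemma primary_null_powers (n : nat) (k : fieldType) (J : {pred mpseries n k}) :
  primary_to J (@null_ideal n k) ->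
  exists2 M, (0 < M)%N & forall i, mpsX k i ^+ M \in J.
Proof.
case=> [[idJ _ _] rad].
have hX i : exists e, mpsX k i ^+ e \in J.
  by apply/rad; apply: mpsX_null.
have [e he] := fin_all_exists hX; exists (\max_i e i).+1 => // i.
have /subnK <- : (e i <= (\max_i e i).+1)%N by rewrite leqW // leq_bigmax.
by rewrite exprD (in_idealMl idJ).
Qed.

Theorem theorem2p5 (n : nat) (k : fieldType) (f : mpseries n k)
    (n_ge2 : (2 <= n)%N)
    (char0 : [pchar k] =i pred0)
    (reduced_f : reduced_ring (hypersurface_ring f))
    (isolated_f : isolated_singularity f) :
  [<-> quasihomogeneous f;
       artinian_ring (tjurina_algebra f) /\
         gorenstein_local_ring (tjurina_algebra f);
       min_num_generators (tjurina_ideal f) n]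
  /\
  (forall (m : nat) (Z : 'M[mpseries n k]_(n + 1, m)),
     presentation_matrix (tjurina_gens f) Z ->
     quasihomogeneous f <-> (0 < \rank (map_mx (@mps_eval0 n k) Z))%N).
Proof.
split; last by move=> m Z; apply: presentation_rank.
have [_ _ primJ primI] := isolated_f.
have [M M_gt0 XJ] := primary_null_powers primJ.
have [[idI nI1 _] radI] := primI.
have JI : {subset jacobian_ideal f <= tjurina_ideal f}.
  by move=> t Jt; apply/tjurina_idealP; exists 0; rewrite mulr0 subr0.
have boxI : {subset box_ideal M n <= tjurina_ideal f}.
  by apply: box_sub_ideal => // i; apply/JI/XJ.
have nilI t : t \in @null_ideal n k -> exists e : nat, t ^+ e \in tjurina_ideal f.
  by move/radI.
have Inull := tjurina_sub_null isolated_f.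
have [phi frJ] := complete_intersection_frobenius char0 M_gt0 XJ.
have IJ : quasihomogeneous f -> tjurina_ideal f =i jacobian_ideal f.
  move=> Jf t; apply/idP/idP => [/tjurina_idealP[q Jq]|/JI//].
  have idJ : is_ideal (jacobian_ideal f) := ideal_span_is_ideal _.
  by rewrite -(subrK (f * q) t) (in_idealD idJ) // (in_idealMr idJ).
tfae => [qh|[_ gor]|[[h hI] _]].
- split; first exact: quot_artinian M_gt0 boxI.
  (* When f is in J the ideals I and J agree, so the functional of the complete intersection J
     serves for I. *)
  have [lin phi0 nondeg rep] := frJ.
  apply: (frobenius_quot_gorenstein M_gt0 boxI nilI Inull (phi := phi)) => //.
  split=> // [t It|t ht|psi linpsi psi0].
  + by apply: phi0; rewrite -[_ \in _](IJ qh).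
  + by apply/JI/nondeg.
  + exact: rep linpsi (fun t Jt => psi0 t (JI t Jt)).
(* (b) yields (c) through (a): were f not quasihomogeneous, every syzygy would have its entries in
   the maximal ideal, against [gorenstein_unit_syzygy]. *)
- have qh : quasihomogeneous f.
    apply: contrapT => nq.
    have [psi frI] := gorenstein_quot_frobenius M_gt0 boxI nilI Inull nI1 gor.
    apply: (gorenstein_unit_syzygy char0 idI Inull (tjurina_idealP f) frJ frI).
    move=> c t rel'.
    have rel : \sum_j mps_deriv j f * c j + f * t = 0.
      by apply: etrans rel'; congr (_ + _); apply: eq_bigr => j _; rewrite mxE.
    split=> [|i]; last exact: (syzygy_null char0 isolated_f i rel).
    apply: contra_notT nq; exact: (unit_syzygy_quasihomogeneous isolated_f rel).
  split; first by exists (jacobian_gens f) => t; rewrite -(IJ qh).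
  by move=> s g gI; case: (num_generators_ge char0 isolated_f gI).
- apply: contrapT => nq.
  have [_ /(_ nq)] := num_generators_ge char0 isolated_f hI.
  by rewrite ltnn.
Qed.
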